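(* Let $\pi$ be a pattern of length $3$ (classical, vincular or consecutive) and let $x_n$ be the number of elements of $\mathcal S_n$ that avoid $\pi$ ($n\ge0$, $x_0=1$). Then $(x_n)_{n\ge0}$ is the sequence of moments of some positive Borel measure on the real line (i.e. there is a positive Borel measure $\mu$ on $\mathbb R$ with $\int_{\mathbb R}x^n\,d\mu(x)=x_n$ for all $n\ge0$) if and only if the ordinary generating function $\sum_{n\ge0}x_nz^n$ is a special case of $\mathcal C(z)$, that is, equals $\mathcal C_{a,b,c,d,f,g,h,\ell,p,r,s,t,u,w}(z)$ for some real values of the parameters.
   Context: $\mathcal S_n$ is the set of permutations of $[n]=\{1,\dots,n\}$. A pattern of length $m$ is a permutation $\pi$ of $[m]$ written as a word whose letters are partitioned by dashes into contiguous blocks. An occurrence of $\pi$ in $\sigma\in\mathcal S_n$ is a tuple $i_1<\dots<i_m$ such that $\sigma(i_j)<\sigma(i_k)$ if and only if $\pi(j)<\pi(k)$, and such that $i_{j+1}=i_j+1$ whenever $\pi(j)$ and $\pi(j+1)$ lie in the same block. The pattern is classical if there is no adjacency requirement (all blocks are singletons), consecutive if there is a single block, and vincular in general. A permutation avoids $\pi$ if it contains no occurrence of $\pi$. For $n\ge1$, $[n]_{x,y}:=\sum_{i=0}^{n-1}x^{n-1-i}y^{i}$, and $[0]_{x,y}:=0$, with the convention $0^0=1$. For real parameters $a,b,c,d,f,g,h,\ell,p,r,s,t,u,w$, $\mathcal C(z)=\mathcal C_{a,b,c,d,f,g,h,\ell,p,r,s,t,u,w}(z)$ is the formal power series in $z$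 defined by the continued fraction $$\mathcal C(z)=\cfrac{1}{1-\alpha_0z-\cfrac{\beta_1z^2}{1-\alpha_1z-\cfrac{\beta_2z^2}{\ddots}}},\qquad \alpha_n=u\,w^n+s\,[n]_{a,b}+t\,[n]_{f,g}\ (n\ge 0),\quad \beta_n=p\,r\,[n]_{c,d}\,[n]_{h,\ell}\ (n\ge 1).$$ *)

(* Defs.v *)
From mathcomp Require Import all_boot all_order all_fingroup all_algebra.
From mathcomp Require Import all_classical all_reals all_analysis.

Set Implicit Arguments.
Unset Strict Implicit.
Unset Printing Implicit Defensive.

Import Order.TTheory GRing.Theory Num.Theory.

Local Open Scope ring_scope.

(* Letters and positions are numbered from 0.  [j \in dashes p] means that a
   dash separates the letters in positions j and j.+1 of the word of p, so that
   these two letters lie in the same block exactly when [j \notin dashes p]. *)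
Record pattern (m : nat) := Pattern {
  word : 'S_m;
  dashes : {set 'I_m.-1}
}.

Section Patterns.
Variables m n : nat.
Implicit Types (p : pattern m) (s : 'S_n).

Definition occurrence p s (i : {ffun 'I_m -> 'I_n}) : bool :=
  [&& [forall j : 'I_m, forall k : 'I_m, (j < k)%N ==> (i j < i k)%N],
      [forall j : 'I_m, forall k : 'I_m, (s (i j) < s (i k))%N == (word p j < word p k)%N] &
      [forall d : 'I_m.-1, forall j : 'I_m, forall k : 'I_m,
         [&& d \notin dashes p, val j == d & val k == d.+1] ==>
         (val (i k) == (i j).+1)]].

Definition avoids p s : bool := ~~ [exists i, occurrence p s i].

End Patterns.

Definition avoid_count (m : nat) (p : pattern m) (n : nat) : nat :=
  #|[set s : 'S_n | avoids p s]|.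

(* A formal power series over R is represented by its coefficients, nat -> R. *)
Section JFraction.
Variable R : comNzRingType.
Implicit Types (g : nat -> R) (al be : nat -> R).

(* 1 / (1 - g(z)) for g(0) = 0, as the geometric series; the coefficient of z^n
   only involves the powers g^k, k <= n, and the coefficients of g up to n.
   [fps_geomE] is the resulting identity F = 1 + g F. *)
Definition fps_geom g (n : nat) : R :=
  (\sum_(k < n.+1) (\poly_(i < n.+1) g i) ^+ k)`_n.

(* The coefficients of a z + b z^2 f(z). *)
Definition jstep (a b : R) (f : nat -> R) (n : nat) : R :=
  match n with 0 => 0 | 1 => a | m.+2 => b * f m end.

(* The N-th convergent of the tail starting at level k: the continued fraction
   1 / (1 - al_k z - be_(k+1) z^2 / (1 - al_(k+1) z - ...)) cut after
   N levels. *)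
Fixpoint jconv al be (N k : nat) : nat -> R :=
  if N is N'.+1 then
    fps_geom (jstep (al k) (be k.+1) (jconv al be N' k.+1))
  else fun=> 0.

(* The z-adic limit of the convergents; see [jconv_stable]. *)
Definition jfrac al be (n : nat) : R := jconv al be n.+1 0 n.

Lemma fps_geomE g n : g 0%N = 0 ->
  fps_geom g n = (n == 0%N)%:R + \sum_(i < n.+1) g i * fps_geom g (n - i).
Proof.
move=> g0.
pose P m : {poly R} := \poly_(i < m) g i.
have coefX m1 m2 k j : (j < m1)%N -> (j < m2)%N ->
    (P m1 ^+ k)`_j = (P m2 ^+ k)`_j.
  elim: k j => [|k IH] j h1 h2; first by rewrite !expr0.
  rewrite !exprS !coefM; apply: eq_bigr => i _.
  have lij : (i <= j)%N by rewrite -ltnS.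
  rewrite !coef_poly (leq_ltn_trans lij h1) (leq_ltn_trans lij h2).
  by rewrite (IH (j - i)%N) // (leq_ltn_trans (leq_subr _ _)).
have coefX0 m k j : (j < k)%N -> (P m ^+ k)`_j = 0.
  elim: k j => [//|k IH] j hj.
  rewrite exprS coefM big1 // => i _; rewrite coef_poly.
  case: (posnP i) => [->|ipos]; first by rewrite g0 if_same mul0r.
  rewrite (IH (j - i)%N) ?mulr0 //.
  have lij : (i <= j)%N by rewrite -ltnS.
  by rewrite ltn_subLR //; apply: leq_trans hj _; rewrite -[k.+1]add1n leq_add2r.
have geomE j : (j <= n)%N ->
    fps_geom g j = (\sum_(k < n.+1) P n.+1 ^+ k)`_j.
  move=> ljn; rewrite /fps_geom -/(P j.+1) !coef_sum.
  rewrite (big_ord_widen n.+1 (fun k => (P j.+1 ^+ k)`_j)) //.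
  rewrite big_mkcond; apply: eq_bigr => k _ /=.
  by case: ltnP => hk; [apply: coefX | rewrite coefX0].
set S := \sum_(k < n.+1) _ in geomE.
have SE : S + P n.+1 ^+ n.+1 = 1 + P n.+1 * S.
  have -> : S + P n.+1 ^+ n.+1 = \sum_(k < n.+2) P n.+1 ^+ k.
    by rewrite big_ord_recr.
  rewrite big_ord_recl expr0 /S big_distrr; congr (_ + _).
  by apply: eq_bigr => i _; rewrite /= -exprS.
transitivity ((S + P n.+1 ^+ n.+1)`_n).
  by rewrite coefD coefX0 // addr0 geomE.
rewrite SE coefD coef1 coefM.
congr (_ + _); apply: eq_bigr => i _.
by rewrite coef_poly ltn_ord geomE ?leq_subr.
Qed.

Lemma jconv_stable al be N n : (n < N)%N -> jconv al be N 0 n = jfrac al be n.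
Proof.
have ext g1 g2 m : (forall i, (i <= m)%N -> g1 i = g2 i) ->
    fps_geom g1 m = fps_geom g2 m.
  move=> e; rewrite /fps_geom.
  suff -> : \poly_(i < m.+1) g1 i = \poly_(i < m.+1) g2 i by [].
  by apply/polyP => i; rewrite !coef_poly; case: ltnP => // /e.
suff st N1 N2 k m : (m < N1)%N -> (m < N2)%N ->
    jconv al be N1 k m = jconv al be N2 k m by move=> h; apply: st.
elim: N1 N2 k m => [//|N1 IH] [//|N2] k m h1 h2 /=.
apply: ext => -[|[|i]] //= hi; congr (_ * _).
by apply: IH; rewrite -ltnS; apply: leq_trans hi _; rewrite // -ltnS ltnW.
Qed.

End JFraction.

Section CFraction.
Variable R : realType.

Definition brack (x y : R) (n : nat) : R :=
  \sum_(i < n) x ^+ (n - 1 - i) * y ^+ i.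

Definition alphaC (a b f g s t u w : R) (n : nat) : R :=
  u * w ^+ n + s * brack a b n + t * brack f g n.

Definition betaC (c d h l p r : R) (n : nat) : R :=
  p * r * brack c d n * brack h l n.

Definition fracC (a b c d f g h l p r s t u w : R) : nat -> R :=
  jfrac (alphaC a b f g s t u w) (betaC c d h l p r).

End CFraction.

Definition is_moment_sequence (R : realType) (x : nat -> R) : Prop :=
  exists mu : {measure set (measurableTypeR R) -> \bar R}, forall n : nat,
    mu.-integrable setT (fun y : measurableTypeR R => (y ^+ n)%:E) /\
    (\int[mu]_y (y ^+ n)%:E = (x n)%:E)%E.

(* Main.v *)
(** Writing J for a Jacobi matrix with diagonal [alpha] and off-diagonal
    products [beta], the coefficients of the J-fraction are the weighted Motzkin
    path sums [(J^n)_(0,0)].  If [beta >= 0], the functional [L(X^n) = x_n] is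
    nonnegative on squares, hence on nonnegative real polynomials; extending it by
    the theorem of M. Riesz to functions of polynomial growth, [x] is the moment
    sequence of the Stieltjes measure of [t |-> L(1_(-oo, t])] (Hamburger).

    Up to reversal and complement, appending a last letter to a permutation gives
    transfer recursions which identify the four counting sequences: Catalan
    numbers ([alpha = 1, 2, 2, ...], [beta = 1]), Bell numbers ([alpha_n = n + 1],
    [beta_n = n]), the consecutive pattern 123 ([alpha_n = n + 1],
    [beta_n = n^2]), all of them in the family C, and the consecutive pattern 132.
    The latter has a negative Hankel determinant, so it is no moment sequence; and
    in the family C its first terms would force [beta_1 = 1] and [beta_2 = 3],
    which already makes every [beta_n] nonnegative. *)

From HB Require Import structures.
Require Import Defs.
From mathcomp Require Import all_boot all_order all_fingroup all_algebra.
From mathcomp Require Import all_classical all_reals all_analysis.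
From mathcomp Require Import measurable_realfun ring lra zify.

Set Implicit Arguments.
Unset Strict Implicit.
Unset Printing Implicit Defensive.

Import Order.TTheory GRing.Theory Num.Theory numFieldNormedType.Exports.

Local Open Scope ring_scope.

(** * Motzkin paths and moment functionals *)

(** The equivalence holds because each class satisfies both sides or neither: in the exceptional
    class, membership in the family would yield a measure by Hamburger's theorem, against the
    negative determinant.

    For the Bell numbers and the consecutive pattern 123 the recurrences are not solved. Counting
    avoiders by their last letter gives binomial convolutions, which are read as identities for the
    moment functional composed with a linear operator on polynomials. Commuting that operator with
    multiplication by X yields polynomials with a three-term recurrence that the functional
    annihilates in positive degree, and the J-fraction is read off. For Catalan numbers the Motzkin
    sums are binomial moments of a statistic on avoiders.

    On the analytic side the extended functional is only known to be finitely additive. Tails and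
    discretization errors are therefore bounded by polynomials over N + 1, so that a single higher
    moment controls both. *)

Section Motzkin.
Variable R : comNzRingType.
Implicit Types al be : nat -> R.

Let below (f : nat -> R) k := if k is j.+1 then f j else 0.

(** Paths of n steps from level 0 to level k: a step up weighs 1, a level step at k weighs [al k], a
    step down from k + 1 weighs [be k.+1]. *)
Fixpoint motz al be (n k : nat) : R :=
  if n is m.+1 then
    (if k is j.+1 then motz al be m j else 0) + al k * motz al be m k +
    be k.+1 * motz al be m k.+1
  else (k == 0)%:R.

Lemma motzS al be n k :
  motz al be n.+1 k = below (motz al be n) k +
    al k * motz al be n k + be k.+1 * motz al be n k.+1.
Proof. by []. Qed.

Lemma motz_gt al be n k : (n < k)%N -> motz al be n k = 0.
Proof.
elim: n k => [|n IH] [|k] //= hk.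
rewrite !IH ?mulr0 ?addr0 ?mulr0 ?addr0 //; lia.
Qed.

(* Split at the last visit to level 0. *)
Lemma motz_last_passage al be n j :
  motz al be n j.+1 = \sum_(i < n)
    motz al be i 0 * motz (al \o S) (be \o S) (n.-1 - i) j.
Proof.
elim: n j => [|n IH] j; first by rewrite big_ord0.
rewrite motzS !IH big_ord_recr /= subnn.
have E (i : 'I_n) : (n - i)%N = (n.-1 - i).+1 by have := ltn_ord i; lia.
under [in RHS]eq_bigr => i _ do rewrite E motzS.
case: j => [|j].
- rewrite !mulr_sumr -addrA -big_split /= addrC mulr1; congr (_ + _).
  by apply: eq_bigr => i _; ring.
- rewrite IH !mulr_sumr -!big_split /= mulr0 addr0.
  by apply: eq_bigr => i _; ring.
Qed.

(** The series F of a level satisfies F = 1 + (al z + be z^2 G) F with G the next level. Paths obey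
    the same equation by the last-passage splitting. The outer induction handles G, the inner one
    the occurrence of F on the right. *)
Lemma jconv_motz al be N k n : (n < N)%N ->
  jconv al be N k n = motz (fun i => al (k + i)%N) (fun i => be (k + i)%N) n 0.
Proof.
elim: N k n => [//|N IH] k n.
have [m] := ubnP n; elim: m n => [//|m IHm] [|n] hm hN.
  by rewrite /= fps_geomE //= big_ord1 /= mul0r addr0.
rewrite /= fps_geomE // add0r big_ord_recl /= mul0r add0r.
rewrite big_ord_recl /= subn1 /=.
have -> : fps_geom (jstep (al k) (be k.+1) (jconv al be N k.+1)) n =
  jconv al be N.+1 k n by [].
rewrite IHm //; last by rewrite ltnW.
rewrite addn0 add0r addn1; congr (_ + _).
case: n hm hN => [|n] hm hN; first by rewrite big_ord0 /= mulr0.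
rewrite motz_last_passage mulr_sumr (reindex_inj rev_ord_inj) /=.
apply: eq_bigr => i _; rewrite /bump /= !add1n subSS.
have hi := ltn_ord i.
rewrite IH; last by lia.
have -> : fps_geom (jstep (al k) (be k.+1) (jconv al be N k.+1))
  (n.+2 - (n.+1 - i.+1).+2) = jconv al be N.+1 k (n.+2 - (n.+1 - i.+1).+2) by [].
rewrite IHm; [|lia|lia].
rewrite (_ : (n.+2 - (n.+1 - i.+1).+2)%N = i); last by lia.
rewrite mulrAC -mulrA add0n; congr (_ * (_ * _)).
by congr motz; apply/funext => j /=; rewrite addSnnS.
Qed.

Lemma jfrac_motz al be n : jfrac al be n = motz al be n 0.
Proof. by rewrite /jfrac jconv_motz. Qed.

(** The Jacobi matrix is symmetric for the bilinear form with weights be_1 ... be_k, so steps can be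
    moved one at a time from one factor to the other. *)
Lemma motz_sym al be i j M : (i + j < M)%N ->
  motz al be (i + j) 0 = \sum_(k < M)
    motz al be i k * motz al be j k * \prod_(l < k) be l.+1.
Proof.
elim: i j => [|i IH] j hM.
  case: M hM => [//|M] _; rewrite big_ord_recl [X in _ + X]big1 => [|k _] /=.
    by rewrite big_ord0 addr0 mul1r mulr1.
  by rewrite !mul0r.
rewrite addSnnS IH ?addnS //; apply/eqP; rewrite -subr_eq0 -sumrB; apply/eqP.
pose h k : R := \prod_(l < k) be l.+1.
pose A i j (k : 'I_M) := below (motz al be i) k * motz al be j k * h k.
pose B i j (k : 'I_M) := be k.+1 * motz al be i k.+1 * motz al be j k * h k.
(* Up-steps of one factor are the down-steps of the other after an index shift; the boundary term
   vanishes because j' < M. *)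
have AB i' j' : (j' < M)%N -> \sum_(k < M) A i' j' k = \sum_(k < M) B j' i' k.
  case: M {IH hM} @A @B => [//|M] A B hj.
  rewrite big_ord_recl big_ord_recr /= /A /B /= !mul0r add0r.
  rewrite (@motz_gt al be j' M.+1) // mulr0 !mul0r addr0.
  apply: eq_bigr => k _ /=; rewrite /bump /= add1n /h big_ord_recr /=.
  by ring.
transitivity (\sum_(k < M) (A j i k - A i j k + (B j i k - B i j k))).
  by apply: eq_bigr => k _; rewrite !motzS /A /B -/(h k); ring.
rewrite big_split /= !sumrB !AB; [|lia|lia].
by ring.
Qed.

End Motzkin.

Section MomentFunctional.
Variables (R : comNzRingType) (x : nat -> R).

Definition momf (p : {poly R}) : R := \sum_(i < size p) p`_i * x i.

Lemma momf_wide n (p : {poly R}) : (size p <= n)%N -> momf p = \sum_(i < n) p`_i * x i.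
Proof.
move=> le; rewrite /momf (big_ord_widen n (fun i => p`_i * x i)) // big_mkcond.
by apply: eq_bigr => i _; case: ltnP => // /leq_sizeP ->; rewrite ?mul0r.
Qed.

Lemma momf_is_linear : scalar momf.
Proof.
move=> a p q; set n := maxn (size p) (size q).
have hp : (size (a *: p + q)%R <= n)%N.
  apply: leq_trans (size_polyD _ _) _; rewrite geq_max leq_maxr andbT.
  by apply: leq_trans (size_scale_leq _ _) (leq_maxl _ _).
rewrite (momf_wide hp) (momf_wide (leq_maxl _ _ : size p <= n)%N).
rewrite (momf_wide (leq_maxr _ _ : size q <= n)%N).
rewrite mulr_sumr -big_split; apply: eq_bigr => i _.
by rewrite coefD coefZ mulrDl mulrA.
Qed.

HB.instance Definition _ :=
  GRing.isLinear.Build R {poly R} R *%R momf momf_is_linear.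

Lemma momfXn n : momf 'X^n = x n.
Proof.
rewrite (@momf_wide n.+1) ?size_polyXn // big_ord_recr /= coefXn eqxx mul1r.
by rewrite big1 ?add0r // => i _; rewrite coefXn ltn_eqF // mul0r.
Qed.

Lemma eq_scalarXn (L L' : {scalar {poly R}}) :
  (forall n, L 'X^n = L' 'X^n) -> L =1 L'.
Proof.
move=> e p; rewrite -[p]coefK poly_def !linear_sum.
by apply: eq_bigr => i _; rewrite !linearZ /= e.
Qed.

End MomentFunctional.

Section Positivity.
Variable R : realFieldType.

(** By [motz_sym] the Hankel form is diagonalized: the value at p^2 is a sum of squares weighted by
    the products be_1 ... be_k. These are the squared norms of the monic orthogonal polynomials, and
    [motz al be i k] are the coordinates of X^i. *)
Lemma momf_sqr_ge0 (al be : nat -> R) (x : nat -> R) :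
  (forall n, 0 <= be n.+1) -> (forall n, x n = jfrac al be n) ->
  forall p, 0 <= momf x (p * p).
Proof.
move=> be0 xE p; set n := size p.
have pE : p = \sum_(i < n) p`_i *: 'X^i by rewrite -poly_def coefK.
pose M := (n + n).+1.
have -> : momf x (p * p) = \sum_(k < M) (\prod_(l < k) be l.+1) *
    (\sum_(i < n) p`_i * motz al be i k) ^+ 2.
  rewrite {1 2}pE mulr_suml linear_sum /=.
  under eq_bigr => i _.
    rewrite mulr_sumr linear_sum /=; under eq_bigr => j _.
      rewrite -scalerAl -scalerAr -exprD !linearZ /= momfXn xE jfrac_motz.
      rewrite (@motz_sym _ _ _ i j M); last first.
        by have := ltn_ord i; have := ltn_ord j; rewrite /M; lia.
      rewrite !mulr_sumr; over.
    rewrite exchange_big /=; over.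
  rewrite exchange_big /=; apply: eq_bigr => k _.
  rewrite expr2 mulr_suml mulr_sumr; apply: eq_bigr => i _.
  by rewrite !mulr_sumr; apply: eq_bigr => j _; ring.
apply: sumr_ge0 => k _; rewrite mulr_ge0 ?sqr_ge0 //.
by apply: prodr_ge0 => l _.
Qed.

End Positivity.

(** * Hamburger's theorem *)

Section NonnegPoly.
Variable R : realType.

Lemma poly_norm_coercive (p : {poly R}) : (1 < size p)%N ->
  forall M : R, exists c : R, forall x, c <= `|x| -> M <= `|p.[x]|.
Proof.
elim/poly_ind: p => [|p a IH]; first by rewrite size_poly0.
rewrite size_MXaddC. case: (eqVneq p 0) => [->|p0] sz M.
  by move: sz; rewrite size_poly0; case: ifP.
have [sp|sp] := ltnP 1 (size p).
- have [c hc] := IH sp (Num.max 0 M + `|a|); exists (Num.max 1 c) => x.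
  rewrite ge_max => /andP[x1 xc]; have := hc _ xc; rewrite !hornerE => h.
  have h1 : `|p.[x] * x| - `|a| <= `|p.[x] * x + a|.
    by have := ler_normD (p.[x] * x + a) (- a); rewrite addrK normrN lerBlDr.
  apply: le_trans h1; rewrite lerBrDr normrM.
  have h2 : M + `|a| <= `|p.[x]|.
    by apply: le_trans h; rewrite lerD2r le_max lexx orbT.
  apply: le_trans h2 _; rewrite ler_peMr //.
- have /size_poly1P[b b0 ->] : size p == 1%N.
    by rewrite eqn_leq sp /= lt0n size_poly_eq0.
  exists ((Num.max 0 M + `|a|) / `|b|) => x hx; rewrite !hornerE.
  have b1 : 0 < `|b| by rewrite normr_gt0.
  have h : Num.max 0 M + `|a| <= `|b * x|.
    by rewrite normrM mulrC -ler_pdivrMr.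
  have h1 : `|b * x| - `|a| <= `|b * x + a|.
    by have := ler_normD (b * x + a) (- a); rewrite addrK normrN lerBlDr.
  apply: le_trans h1; rewrite lerBrDr; apply: le_trans h.
  by rewrite lerD2r le_max lexx orbT.
Qed.

Lemma nonneg_poly_min (q : {poly R}) : (forall x, 0 <= q.[x]) ->
  exists r, forall x, q.[r] <= q.[x].
Proof.
move=> q0; have [sq|sq] := leqP (size q) 1.
  by rewrite (size1_polyC sq); exists 0 => x; rewrite !hornerC.
have [c hc] := poly_norm_coercive sq (q.[0] + 1).
pose b := Num.max 0 c.
have b0 : 0 <= b by rewrite le_max lexx.
have lb : - b <= b by rewrite ge0_cp.
have [|r rb hr] := @EVT_min R (horner q) (- b) b lb.
  by apply: continuous_subspaceT => x; exact: continuous_horner.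
exists r => x; have [xb|xb] := leP `|x| b.
  by apply: hr; rewrite in_itv /= -ler_norml.
have /hc : c <= `|x| by apply: le_trans (ltW xb); rewrite le_max lexx orbT.
rewrite ger0_norm // => h; apply: (@le_trans _ _ q.[0]).
  by apply: hr; rewrite in_itv /= b0 andbT lerNl oppr0.
by apply: le_trans h; rewrite lerDl.
Qed.

Local Open Scope classical_set_scope.

Lemma root_cofactor_of_sign (s : {poly R}) r :
  (forall x, 0 <= s.[x] * (x - r)) -> root s r.
Proof.
move=> h; apply/rootP; apply/eqP; rewrite eq_le; apply/andP.
have cs : horner s x @[x --> r] --> s.[r] by exact: continuous_horner.
split.
- have cl : horner s x @[x --> r^'-] --> s.[r].
    by apply: cvg_at_left_filter.
  apply: (cvgr_to_le cl).
  near=> x; have xr : x < r by near: x; exact: nbhs_left_lt.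
  have := h x; rewrite nmulr_lge0 // ?subr_lt0 //.
- have cl : horner s x @[x --> r^'+] --> s.[r].
    by apply: cvg_at_right_filter.
  apply: (cvgr_to_ge cl).
  near=> x; have xr : r < x by near: x; exact: nbhs_right_gt.
  have := h x; rewrite pmulr_lge0 // ?subr_gt0 //.
Unshelve. all: by end_near. Qed.

(* Subtracting its minimum from [q] leaves a double real root to divide out. *)
Lemma scalar_nonneg_poly (L : {scalar {poly R}}) :
  (forall p, 0 <= L (p * p)) ->
  forall q, (forall x, 0 <= q.[x]) -> 0 <= L q.
Proof.
(* Generalized to L(p^2 q) with p = 1 at the start: the double root divided out of q is absorbed
   into p. *)
move=> Lsq q q0; rewrite -[q]mul1r -[1]mul1r.
have [n] := ubnP (size q); elim: n q q0 (1 : {poly R}) => [//|n IH] q q0 p sq.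
have [r hr] := nonneg_poly_min q0.
pose m := q.[r].
have /factor_theorem[s sE] : root (q - m%:P) r.
  by rewrite rootE !hornerE subrr.
have /factor_theorem[t tE] : root s r.
  apply: root_cofactor_of_sign => x.
  have := congr1 (horner^~ x) sE; rewrite !hornerE => <-.
  by rewrite subr_ge0 hr.
have qE : q = m%:P + ('X - r%:P) * ('X - r%:P) * t.
  by rewrite -[q](subrK m%:P) sE tE; ring.
have t0 x : 0 <= t.[x].
  have pos y : y != r -> 0 <= t.[y].
    move=> yr; have := congr1 (horner^~ y) qE; rewrite !hornerE => e.
    have : 0 <= (y - r) ^+ 2 * t.[y].
      by rewrite expr2 -(addKr m (_ * t.[y])) -e addrC subr_ge0 hr.
    by rewrite pmulr_rge0 // exprn_even_gt0 //= subr_eq0.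
  have [->|/pos//] := eqVneq x r.
  have cl : horner t y @[y --> r^'+] --> t.[r].
    by apply: cvg_at_right_filter; exact: continuous_horner.
  apply: (cvgr_to_ge cl).
  near=> y; apply: pos; rewrite gt_eqF //; near: y; exact: nbhs_right_gt.
have -> : p * p * q = m *: (p * p) +
    (p * ('X - r%:P)) * (p * ('X - r%:P)) * t.
  by rewrite {1}qE -mul_polyC; ring.
rewrite linearP /=; apply: addr_ge0; first by rewrite mulr_ge0 ?Lsq ?q0.
have [->|tn0] := eqVneq t 0; first by rewrite mulr0 linear0.
apply: IH => //; rewrite -ltnS; apply: leq_trans _ sq.
have sqE : size (q - m%:P) = (size t).+2.
  rewrite sE tE size_Mmonic ?monicXsubC ?mulf_neq0 ?polyXsubC_eq0 //.
  by rewrite size_Mmonic ?monicXsubC // !size_XsubC !addn2.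
have := size_polyD q (- m%:P); rewrite sqE size_polyN leq_max => /orP[/ltnW//|].
by move/leq_trans/(_ (size_polyC_leq1 _)).
Unshelve. all: by end_near. Qed.
End NonnegPoly.

(** * Extension of a positive functional to functions of polynomial growth *)

Section RieszExtension.
Variables (R : realType) (L : {scalar {poly R}}).
Hypothesis L_ge0 : forall q, (forall x, 0 <= q.[x]) -> 0 <= L q.

Local Open Scope classical_set_scope.

Definition poly_bounded (f : R -> R) :=
  exists q : {poly R}, forall x, `|f x| <= q.[x].

(* Positive linear functionals are handled through their graphs; positivity
   makes such a graph single-valued. *)
Let positive_graph (G : set ((R -> R) * R)) :=
  (forall a f u g v, G (f, u) -> G (g, v) ->
     G (fun x => f x + a * g x, u + a * v)) /\
  (forall f u, G (f, u) -> (forall x, 0 <= f x) -> 0 <= u).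

Let G0 : set ((R -> R) * R) := [set p | exists q, p = (horner q, L q)].

Let positive_graph0 : positive_graph G0.
Proof.
split=> [a f u g v [p [-> ->]] [q [-> ->]]|f u [p [-> ->]]]; last exact: L_ge0.
exists (p + a *: q); congr pair; last by rewrite linearD linearZ.
by apply/funext => x; rewrite !hornerE.
Qed.

(** Adjoining [G0] to every set makes the empty chain admissible, its union being empty. Since the
    chain is total, any two points of the union lie in a common member. *)
Let chain_union (F : set (set ((R -> R) * R))) :
  F `<=` [set A | positive_graph (A `|` G0)] -> total_on F subset ->
  positive_graph ((\bigcup_(X in F) X) `|` G0).
Proof.
move=> FP tot; set U := _ `|` G0.
have two p1 p2 : U p1 -> U p2 ->
    exists X, [/\ positive_graph X, X `<=` U, X p1 & X p2].
  have sub A : F A -> A `|` G0 `<=` U.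
    by move=> FA p [Ap|]; [left; exists A|right].
  case=> [[A FA A1]|h1] [[B FB B2]|h2].
  - have [AB|BA] := tot _ _ FA FB.
      exists (B `|` G0); split; [exact: FP|exact: sub|left; exact: AB|by left].
    exists (A `|` G0); split; [exact: FP|exact: sub|by left|left; exact: BA].
  - exists (A `|` G0); split; [exact: FP|exact: sub|by left|by right].
  - exists (B `|` G0); split; [exact: FP|exact: sub|by right|by left].
  - by exists G0; split=> //; right.
split=> [a f u g v fu gv|f u fu].
- by have [X [[lin _] XU Xf Xg]] := two _ _ fu gv; apply: XU; exact: lin.
- by have [X [[_ pos] _ Xf _]] := two _ _ fu fu; exact: pos.
Qed.

Let extension_graph : exists G : set ((R -> R) * R),
  [/\ positive_graph G, G0 `<=` G &
      forall f, poly_bounded f -> exists u, G (f, u)].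
Proof.
have [A [PA maxA]] := Zorn_bigcup chain_union.
set G := A `|` G0 in PA; have [lin pos] := PA.
have G0G : G0 `<=` G by move=> p; right.
exists G; split=> // f [q hq]; apply: contrapT => nf.
have leG g u g' u' : G (g, u) -> G (g', u') -> (forall x, g x <= g' x) -> u <= u'.
  move=> gu gu' le; have := pos _ _ (lin (-1) _ _ _ _ gu' gu).
  by rewrite mulN1r subr_ge0; apply=> x; rewrite mulN1r subr_ge0.
have GP p : G (horner p, L p) by apply: G0G; exists p.
pose Lo := [set v | exists g, G (g, v) /\ forall x, g x <= f x].
have supLo : has_sup Lo.
  split.
    exists (L (- q)), (horner (- q)); split=> // x.
    by rewrite hornerN lerNl; apply: le_trans (hq x); rewrite -normrN ler_norm.
  exists (L q) => v [g [gv gf]]; apply: (leG _ _ _ _ gv (GP q)) => x.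
  by apply: le_trans (gf x) (le_trans _ (hq x)); exact: ler_norm.
pose c := sup Lo.
have loc g v : G (g, v) -> (forall x, g x <= f x) -> v <= c.
  by move=> gv gf; apply: sup_ubound; [case: supLo|exists g].
have upc g v : G (g, v) -> (forall x, f x <= g x) -> c <= v.
  move=> gv gf; apply: ge_sup; first by case: supLo.
  move=> v' [g' [gv' gf']]; apply: leG gv' gv _ => x.
  exact: le_trans (gf' x) (gf x).
pose B := [set p | exists g v t,
  G (g, v) /\ p = ((fun x => g x + t * f x) : R -> R, v + t * c)].
have GB : G `<=` B.
  move=> [g v] gv; exists g, v, 0; split=> //.
  by congr pair; rewrite ?mul0r ?addr0 //; apply/funext => x; rewrite mul0r addr0.
have BG0 : B `|` G0 = B by apply/setUidl => p /G0G/GB.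
have scal t g v : G (g, v) -> G (fun x => t * g x, t * v).
  move=> gv; have := lin t _ _ _ _ (GP 0) gv.
  rewrite linear0 add0r; congr (G (_, _)).
  by apply/funext => x; rewrite horner0 add0r.
apply: (maxA B).
  split; first by move=> p Ap; apply: GB; left.
  move=> BA; apply: nf; exists c; left; apply: BA.
  exists (horner 0), (L 0), 1; split=> //; congr pair.
    by apply/funext => x; rewrite horner0 add0r mul1r.
  by rewrite linear0 add0r mul1r.
rewrite /= BG0; split=> [a _ _ _ _ [g [v [t [gv [-> ->]]]]] [g' [v' [t' [gv' [-> ->]]]]]|].
  exists (fun x => g x + a * g' x), (v + a * v'), (t + a * t'); split.
    exact: lin.
  by congr pair; [apply/funext => x|]; ring.
move=> _ _ [g [v [t [gv [-> ->]]]]] ge.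
(* Dividing g + t f >= 0 by |t| turns it into a bound of f by an element of the domain, from above
   if t < 0 and from below if t > 0; c satisfies the corresponding bound on values. *)
have [t0|t0|t0] := ltgtP t 0.
- have := upc _ _ (scal (- t^-1) _ _ gv).
  have tN : 0 < - t by rewrite oppr_gt0.
  have e y z : (y <= - t^-1 * z) = (0 <= z + t * y).
    by rewrite -invrN mulrC ler_pdivlMr // mulrN lerNl -subr_ge0 opprK addrC mulrC.
  by rewrite e; apply=> x; rewrite e.
- have := loc _ _ (scal (- t^-1) _ _ gv).
  have e y z : (- t^-1 * z <= y) = (0 <= z + t * y).
    by rewrite mulNr mulrC lerNl ler_pdivlMr // mulNr lerNl -subr_ge0 opprK addrC mulrC.
  by rewrite e; apply=> x; rewrite e.
- rewrite t0 mul0r addr0; apply: (pos _ _ gv) => x.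
  by have := ge x; rewrite t0 mul0r addr0.
Qed.

Lemma riesz_extension : exists Lam : (R -> R) -> R,
  [/\ forall a f g, poly_bounded f -> poly_bounded g ->
        Lam (fun x => f x + a * g x) = Lam f + a * Lam g,
      forall f, poly_bounded f -> (forall x, 0 <= f x) -> 0 <= Lam f &
      forall q, Lam (horner q) = L q].
Proof.
have [G [[lin pos] G0G dom]] := extension_graph.
exists (fun f => xget 0 [set u | G (f, u)]).
have LamE f u : G (f, u) -> xget 0 [set u | G (f, u)] = u.
  move=> fu; case: xgetP => [v _ fv|/(_ u)//].
  apply/eqP; rewrite eq_le -(subr_ge0 u) -(subr_ge0 v) -![_ - _]addrC.
  have sub w w' : G (f, w) -> G (f, w') -> 0 <= - w' + w.
    move=> fw fw'; have := pos _ _ (lin (-1) _ _ _ _ fw fw').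
    by rewrite mulN1r addrC; apply=> x; rewrite mulN1r subrr.
  by rewrite !sub.
split=> [a f g /dom[u fu] /dom[v gv]|f /dom[u fu]|q].
- by rewrite (LamE _ _ fu) (LamE _ _ gv); apply: LamE; exact: lin.
- by rewrite (LamE _ _ fu); exact: pos.
- by apply: LamE; apply: G0G; exists q.
Qed.

End RieszExtension.

(** * Uniform approximation of powers by step functions, with polynomial error *)

Section StepFunctions.
Variable R : realType.

Definition grid (N i : nat) : R := - N.+1%:R + i%:R / N.+1%:R.

Definition ray (a y : R) : R := if y <= a then 1 else 0.

(** The cells have width 1/(N+1) and cover ]-(N+1), N+1], translated by h. The sum takes the value
    [grid N i ^+ n] on the i-th cell and 0 outside the grid. *)
Definition step_pow (n N : nat) (h y : R) : R :=
  \sum_(i < 2 * N.+1 * N.+1) grid N i ^+ n *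
    (ray (grid N i.+1 + h) y - ray (grid N i + h) y).

(** The natural bounds are powers of |y| + 2, replaced by the polynomial y^2 + 3 that dominates it.
    The factor 2 accounts for the cell width plus the shift, and the exponent n + 1 for the points
    outside the grid. *)
Definition step_err (n : nat) : {poly R} :=
  (2 * n.+1)%:R *: ('X^2 + 3%:P) ^+ n.+1.

Lemma step_sumE K (x c : nat -> R) z : (forall i, x i <= x i.+1) ->
  ((z <= x 0 \/ x K < z) /\
    \sum_(i < K) c i * (ray (x i.+1) z - ray (x i) z) = 0) \/
  (exists i, [/\ (i < K)%N, x i < z, z <= x i.+1 &
    \sum_(i < K) c i * (ray (x i.+1) z - ray (x i) z) = c i]).
Proof.
move=> inc; elim: K => [|K IH].
  by left; rewrite big_ord0; split=> //; case: (leP z (x 0)) => ?; [left|right].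
rewrite big_ord_recr /=; case: IH => [[[z0|zK] ->]|[i [iK zi zi1 ->]]].
- left; split; first by left.
  have z1 i : z <= x i by elim: i => [//|i IH]; apply: le_trans IH _.
  by rewrite /ray !z1 subrr mulr0 addr0.
- rewrite /ray [z <= x K]leNgt zK /= subr0 add0r.
  case: (leP z (x K.+1)) => zK1.
    by right; exists K; rewrite mulr1 ltnSn.
  by left; split; [right|rewrite mulr0].
- right; exists i; split=> //; first exact: leqW.
  have mono j : (i < j)%N -> z <= x j.
    elim: j => [//|j IHj]; rewrite ltnS leq_eqVlt => /orP[/eqP<-//|/IHj h].
    exact: le_trans h _.
  by rewrite /ray !mono // ?subrr ?mulr0 ?addr0 // ltnW.
Qed.

Lemma ler_dist_pow (x y d : R) n : `|y - x| <= d -> d <= 2 ->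
  `|y ^+ n - x ^+ n| <= d * n%:R * (`|y| + 2) ^+ n.
Proof.
move=> xy d2; have d0 : 0 <= d by apply: le_trans xy.
have y2 : 0 <= `|y| + 2 by rewrite addr_ge0.
have xle : `|x| <= `|y| + 2.
  have := ler_normD y (x - y); rewrite [y + _]addrC subrK distrC.
  by move/le_trans; apply; rewrite lerD2l; exact: le_trans xy d2.
elim: n => [|n IH]; first by rewrite !expr0 subrr normr0 mulr0 mul0r.
have -> : y ^+ n.+1 - x ^+ n.+1 = x * (y ^+ n - x ^+ n) + y ^+ n * (y - x).
  by rewrite !exprS; ring.
apply: le_trans (ler_normD _ _) _; rewrite !normrM normrX.
have -> : d * n.+1%:R * (`|y| + 2) ^+ n.+1 =
  (`|y| + 2) * (d * n%:R * (`|y| + 2) ^+ n) + (`|y| + 2) ^+ n.+1 * d.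
  by rewrite exprS -natr1; ring.
apply: lerD; first exact: ler_pM.
apply: ler_pM => //; rewrite -?normrX ?normr_ge0 // ?normrX.
apply: (@le_trans _ _ ((`|y| + 2) ^+ n)); first by rewrite lerXn2r ?nnegrE // lerDl.
by apply: ler_weXn2l => //; have := normr_ge0 y; lra.
Qed.

Lemma step_pow_approx n N (h y : R) : 0 <= h <= N.+1%:R^-1 ->
  `|y ^+ n - step_pow n N h y| <= (step_err n).[y] / N.+1%:R.
Proof.
move=> /andP[h0 hN].
have [M [M1 ME gE gK]] : exists M : R, [/\ 1 <= M, N.+1%:R = M,
    forall i, grid N i = - M + i%:R / M & grid N (2 * N.+1 * N.+1) = M].
  exists N.+1%:R; split=> //; first by rewrite ler1n.
  by rewrite /grid natrM mulfK ?pnatr_eq0 // natrM; ring.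
rewrite ME in hN *.
have N0 : 0 < M by lra.
have N1 : M^-1 <= 1 by rewrite invf_le1.
have Ni0 : 0 < M^-1 by rewrite invr_gt0.
have w0 : `|y| + 2 <= y ^+ 2 + 3.
  rewrite -real_normK ?num_real //.
  by have := sqr_ge0 (`|y| - 1); rewrite sqrrB1; have := normr_ge0 y; nra.
have w1 : 1 <= y ^+ 2 + 3 by have := sqr_ge0 y; lra.
have ay0 : 0 <= `|y| + 2 by have := normr_ge0 y; lra.
have wle k : (k <= n.+1)%N -> (`|y| + 2) ^+ k <= (y ^+ 2 + 3) ^+ n.+1.
  move=> kn; apply: (@le_trans _ _ ((y ^+ 2 + 3) ^+ k)).
    by rewrite lerXn2r ?nnegrE //; lra.
  exact: ler_weXn2l.
have wge : 0 <= (y ^+ 2 + 3) ^+ n.+1 by apply: exprn_ge0; lra.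
have -> : (step_err n).[y] = (2 * n.+1)%:R * (y ^+ 2 + 3) ^+ n.+1.
  by rewrite /step_err hornerZ horner_exp hornerD hornerXn hornerC.
have shift i : ray (grid N i + h) y = ray (grid N i) (y - h).
  by rewrite /ray lerBlDr.
have inc i : grid N i <= grid N i.+1.
  by rewrite !gE lerD2l ler_pM2r // ler_nat.
rewrite /step_pow; under eq_bigr => i _ do rewrite !shift.
have [] := @step_sumE (2 * N.+1 * N.+1) (grid N) (fun i => grid N i ^+ n) (y - h) inc.
  (* Outside the grid the error is |y|^n, and |y| + 2 is at least N + 1: one more power of |y| + 2
     pays for the denominator. *)
  case=> out ->; rewrite subr0 normrX ler_pdivlMr //.
  have Ny : M <= `|y| + 2.
    case: out; rewrite ?gK ?gE ?mul0r ?addr0 => yl.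
      by have := ler_norm (- y); rewrite normrN; lra.
    by have := ler_norm y; lra.
  apply: (@le_trans _ _ ((`|y| + 2) ^+ n.+1)).
    rewrite exprSr; apply: ler_pM => //; rewrite ?exprn_ge0 //; first by lra.
    by rewrite lerXn2r ?nnegrE // lerDl.
  by apply: le_trans (wle _ (leqnn _)) _; rewrite ler_peMl // ler1n muln_gt0.
case=> i [_ li ri ->].
have gS : grid N i.+1 = grid N i + M^-1 by rewrite !gE -natr1; ring.
rewrite gS in ri.
have dist : `|y - grid N i| <= 2 * M^-1.
  by rewrite ler_norml; apply/andP; split; lra.
apply: le_trans (ler_dist_pow n dist _) _; first by lra.
rewrite natrM -[2 * M^-1 * _]mulrA -!mulrA ler_pM2l //.
rewrite [leRHS]mulrA mulrC -mulrA [leRHS]mulrC.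
rewrite [leRHS]mulrAC ler_pM2r // [leRHS]mulrC.
by apply: ler_pM; rewrite ?exprn_ge0 ?ler_nat ?wle ?ler0n.
Qed.

End StepFunctions.

(** * The Stieltjes measure of the right limits *)

Section RightRegularization.
Variables (R : realType) (F : R -> R).
Hypotheses (F_nd : nondecreasing F) (F_ge0 : forall x, 0 <= F x).

Local Open Scope classical_set_scope.

Definition right_lim (x : R) : R := inf [set F y | y in `]x, +oo[].

Let inf_set (G : R -> R) x : (forall x, 0 <= G x) ->
  has_lbound [set G y | y in `]x, +oo[].
Proof. by move=> G0; exists 0 => _ [y _ <-]. Qed.

Lemma right_lim_le x y : x < y -> right_lim x <= F y.
Proof.
move=> xy; apply: ge_inf; first exact: inf_set.
by exists y => //=; rewrite in_itv /= xy.
Qed.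

Lemma le_right_lim x : F x <= right_lim x.
Proof.
apply: lb_le_inf; first by exists (F (x + 1)), (x + 1) => //=; rewrite in_itv /= ltrDl ltr01.
move=> z [y /=]; rewrite in_itv /= andbT => xy <-.
by apply: F_nd; exact: ltW.
Qed.

Lemma right_lim_nd : nondecreasing right_lim.
Proof.
move=> x y; rewrite le_eqVlt => /predU1P[->//|xy].
exact: le_trans (right_lim_le xy) (le_right_lim y).
Qed.

Lemma right_lim_right_continuous : right_continuous right_lim.
Proof.
move=> x; have G0 y : 0 <= right_lim y by apply: le_trans (le_right_lim y).
suff -> : right_lim x = inf [set right_lim y | y in `]x, +oo[].
  apply: nondecreasing_at_right_cvgr => //; last exact: inf_set.
  by move=> u v _ _; exact: right_lim_nd.
apply/eqP; rewrite eq_le; apply/andP; split.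
- apply: lb_le_inf.
    by exists (right_lim (x + 1)), (x + 1) => //=; rewrite in_itv /= ltrDl ltr01.
  move=> z [y /=]; rewrite in_itv /= andbT => xy <-.
  by apply: right_lim_nd; exact: ltW.
- apply: lb_le_inf.
    by exists (F (x + 1)), (x + 1) => //=; rewrite in_itv /= ltrDl ltr01.
  move=> z [y /=]; rewrite in_itv /= andbT => xy <-.
  have [w xw wy] : exists2 w, x < w & w < y.
    by exists ((x + y) / 2); rewrite ?midf_lt.
  apply: le_trans (right_lim_le wy); apply: ge_inf; first exact: inf_set.
  by exists w => //=; rewrite in_itv /= xw.
Qed.

HB.instance Definition _ := isCumulative.Build R _ R right_lim
  right_lim_nd right_lim_right_continuous.

Definition right_lim_measure : {measure set (measurableTypeR R) -> \bar R} :=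
  lebesgue_stieltjes_measure right_lim.

Lemma right_lim_measure_itv (a b : R) : a <= b ->
  right_lim_measure `]a, b] = (right_lim b - right_lim a)%:E.
Proof.
move=> ab; have -> : right_lim_measure `]a, b] = ((wlength right_lim)^*)%mu `]a, b] by [].
rewrite measurable_mu_extE /=; last exact: is_ocitv.
by rewrite wlength_itv_bnd.
Qed.

Lemma integral_ray_sum K (x c : nat -> R) : (forall i, x i <= x i.+1) ->
  right_lim_measure.-integrable setT (fun y : measurableTypeR R =>
    (\sum_(i < K) c i * (ray (x i.+1) y - ray (x i) y))%:E) /\
  (\int[right_lim_measure]_y
     (\sum_(i < K) c i * (ray (x i.+1) y - ray (x i) y))%:E =
   (\sum_(i < K) c i * (right_lim (x i.+1) - right_lim (x i)))%:E)%E.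
Proof.
move=> inc.
have rayE i y : ray (x i.+1) y - ray (x i) y = \1_(`]x i, x i.+1] : set R) y :> R.
  rewrite indicE /ray; have [h|h] := leP y (x i).
    rewrite (le_trans h (inc i)) subrr memNset //= in_itv /= => /andP[].
    by rewrite ltNge h.
  have [h'|h'] := leP y (x i.+1).
    by rewrite subr0 mem_set //= in_itv /= h h'.
  by rewrite subr0 memNset //= in_itv /= => /andP[_]; rewrite leNgt h'.
have mitv i : measurable (`]x i, x i.+1] : set (measurableTypeR R)).
  exact: measurable_itv.
have E (y : measurableTypeR R) : (\sum_(i < K) c i * (ray (x i.+1) y - ray (x i) y))%:E =
   (\sum_(i < K) (c i)%:E * (\1_(`]x i, x i.+1] : set (measurableTypeR R)) y)%:E)%E.
  by rewrite -sumEFin; apply: eq_bigr => i _; rewrite rayE EFinM.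
have int1 i : right_lim_measure.-integrable setT
    (fun y => (\1_(`]x i, x i.+1] : set (measurableTypeR R)) y)%:E).
  apply/integrableP; split.
    by apply/measurable_EFinP; exact: measurable_indic.
  under eq_integral => y _ do rewrite gee0_abs ?lee_fin ?indic_ge0 //.
  by rewrite integral_indic // setIT right_lim_measure_itv // ltey.
rewrite (funext E).
split; first by apply: integrable_sum => // i _; exact: integrableZl.
rewrite integral_sum //; last by move=> i; exact: integrableZl.
rewrite -sumEFin; apply: eq_bigr => i _.
rewrite integralZl // integral_indic // setIT right_lim_measure_itv //.
Qed.

End RightRegularization.

(** * From the positive functional to its representing measure *)

Section Hamburger.
Variables (R : realType) (x : nat -> R).

Local Open Scope classical_set_scope.

Lemma cvg_harmonic_bound (u : nat -> R) (l C : R) :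
  (forall N, `|l - u N| <= C / N.+1%:R) -> u @ \oo --> l.
Proof.
move=> h.
have z : (fun N => C * harmonic N) @ \oo --> (0 : R).
  by rewrite -(mulr0 C); apply: cvgMr; exact: cvg_harmonic.
apply/cvgrPdist_le => e e0; near=> N.
apply: le_trans (h N) _; apply: le_trans (ler_norm _) _; rewrite -[C / _]subr0 distrC.
by near: N; move/cvgrPdist_le : z; apply.
Unshelve. all: by end_near. Qed.

Variable Lam : (R -> R) -> R.
Hypotheses
  (LamD : forall a f g, poly_bounded f -> poly_bounded g ->
     Lam (fun y => f y + a * g y) = Lam f + a * Lam g)
  (Lam_ge0 : forall f, poly_bounded f -> (forall y, 0 <= f y) -> 0 <= Lam f)
  (Lam_horner : forall q, Lam (horner q) = momf x q).

Let pb_horner (q : {poly R}) : poly_bounded (horner q).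
Proof.
exists (q * q + 1) => y; rewrite !hornerE -expr2.
rewrite -real_normK ?num_real //.
by have := sqr_ge0 (`|q.[y]| - 1); rewrite sqrrB1; have := normr_ge0 q.[y]; nra.
Qed.

Let pb_ray a : poly_bounded (@ray R a).
Proof.
by exists 1 => y; rewrite hornerE /ray; case: ifP; rewrite ?normr1 ?normr0.
Qed.

Let pbD a (f g : R -> R) : poly_bounded f -> poly_bounded g ->
  poly_bounded (fun y => f y + a * g y).
Proof.
move=> [p hp] [q hq]; exists (p + `|a| *: q) => y.
rewrite !hornerE; apply: le_trans (ler_normD _ _) _.
by rewrite normrM lerD // ler_wpM2l.
Qed.

Let Lam_mono (f g : R -> R) : poly_bounded f -> poly_bounded g ->
  (forall y, f y <= g y) -> Lam f <= Lam g.
Proof.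
move=> pf pg fg; rewrite -subr_ge0 -mulN1r -LamD //.
by apply: Lam_ge0 => [|y]; [exact: pbD|rewrite mulN1r subr_ge0].
Qed.

Let Lam_ray_sum K (a b c : nat -> R) :
  let s y := \sum_(i < K) c i * (ray (b i) y - ray (a i) y) in
  poly_bounded s /\
  Lam s = \sum_(i < K) c i * (Lam (ray (b i)) - Lam (ray (a i))).
Proof.
elim: K => [|K [IHpb IH]] /=.
  have -> : (fun y => \sum_(i < 0) c i * (ray (b i) y - ray (a i) y)) =
      horner (0 : {poly R}).
    by apply/funext => y; rewrite big_ord0 horner0.
  by split; [exact: pb_horner|rewrite big_ord0 Lam_horner linear0].
have pbd : poly_bounded (fun y => ray (b K) y + -1 * ray (a K) y) by exact: pbD.
have -> : (fun y => \sum_(i < K.+1) c i * (ray (b i) y - ray (a i) y)) =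
    (fun y => \sum_(i < K) c i * (ray (b i) y - ray (a i) y) +
       c K * (ray (b K) y + -1 * ray (a K) y)).
  by apply/funext => y; rewrite big_ord_recr /= mulN1r.
split; first exact: pbD.
by rewrite LamD // IH LamD // mulN1r big_ord_recr.
Qed.

Let F a := Lam (ray a).

Let F_nd : nondecreasing F.
Proof.
move=> a b ab; apply: Lam_mono => // y; rewrite /ray.
by case: ifPn => ya; case: ifPn => yb //; rewrite (le_trans ya ab) in yb.
Qed.

Let F_ge0 a : 0 <= F a.
Proof. by apply: Lam_ge0 => // y; rewrite /ray; case: ifP. Qed.

Let cvg_shift a : F (a + h) @[h --> 0^'+] --> right_lim F a.
Proof.
have -> : right_lim F a = inf [set F (a + h) | h in `](0 : R), +oo[].
  congr inf; apply/seteqP; split=> z [h /=]; rewrite in_itv /= andbT => h0 <-.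
    by exists (h - a); [rewrite /= in_itv /= subr_gt0 h0|rewrite addrC subrK].
  by exists (a + h) => //; rewrite /= in_itv /= ltrDl h0.
apply: nondecreasing_at_right_cvgr => //.
  by move=> u v _ _ uv; apply: F_nd; rewrite lerD2l.
by exists 0 => _ [y _ <-].
Qed.

(** A Riemann-Stieltjes sum for the n-th moment: it is the integral of [step_pow n N 0] against the
    measure. *)
Let J n N := \sum_(i < 2 * N.+1 * N.+1) grid R N i ^+ n *
  (right_lim F (grid R N i.+1) - right_lim F (grid R N i)).

(* [F] need not be right-continuous: the grid is shifted by [h > 0], and [h --> 0+]
   replaces [F] by its right limits. *)
Let J_approx n N : `|x n - J n N| <= momf x (step_err R n) / N.+1%:R.
Proof.
have N0 : 0 < N.+1%:R^-1 :> R by rewrite invr_gt0 ltr0n.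
pose Jh h := \sum_(i < 2 * N.+1 * N.+1) grid R N i ^+ n *
  (F (grid R N i.+1 + h) - F (grid R N i + h)).
have cJ : (fun h => `|x n - Jh h|) @ 0^'+ --> `|x n - J n N|.
  apply: cvg_norm; apply: cvgB; first exact: cvg_cst.
  apply: cvg_big => [|i _]; first exact: add_continuous.
  apply: cvgMr; apply: cvgB; exact: cvg_shift.
apply: (cvgr_to_le cJ); near=> h.
have h0 : 0 <= h.
  by apply: ltW; near: h; exact: nbhs_right_gt.
have hN : h <= N.+1%:R^-1.
  by near: h; exact: nbhs_right_le.
have [pbs Ls] := Lam_ray_sum (2 * N.+1 * N.+1) (fun i => grid R N i + h)
  (fun i => grid R N i.+1 + h) (fun i => grid R N i ^+ n).
have app y := @step_pow_approx R n N h y (introT andP (conj h0 hN)).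
have LE : Lam (fun y => 'X^n.[y] + -1 * step_pow n N h y) = x n - Jh h.
  by rewrite LamD // Lam_horner momfXn Ls mulN1r.
rewrite -LE; set f := (fun y => _).
pose W : {poly R} := N.+1%:R^-1 *: step_err R n.
have -> : momf x (step_err R n) / N.+1%:R = Lam (horner W).
  by rewrite Lam_horner /W [in RHS]linearZ /= [RHS]mulrC.
have pbf : poly_bounded f by exact: pbD.
have fW y : - W.[y] <= f y <= W.[y].
  by rewrite -ler_norml /f hornerXn mulN1r hornerZ [leRHS]mulrC; exact: app.
rewrite ler_norml; apply/andP; split.
- have -> : - Lam (horner W) = Lam (horner (- W)) by rewrite !Lam_horner linearN.
  apply: Lam_mono => // y.
  by rewrite hornerN; case/andP: (fW y).
- by apply: Lam_mono => // y; case/andP: (fW y).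
Unshelve. all: by end_near. Qed.

Let mu := right_lim_measure F_nd F_ge0.

Let cvgJ n : J n @ \oo --> x n.
Proof. by apply: (@cvg_harmonic_bound _ _ (momf x (step_err R n))); exact: J_approx. Qed.

Let grid_le N i : grid R N i <= grid R N i.+1.
Proof. by rewrite /grid lerD2l ler_pM2r ?invr_gt0 ?ltr0n // ler_nat. Qed.

Let step_int n N : mu.-integrable setT (fun y : measurableTypeR R => (step_pow n N 0 y)%:E) /\
  (\int[mu]_y (step_pow n N 0 y)%:E = (J n N)%:E)%E.
Proof.
have -> : (fun y : measurableTypeR R => (step_pow n N 0 y)%:E) =
  (fun y => (\sum_(i < 2 * N.+1 * N.+1) grid R N i ^+ n *
    (ray (grid R N i.+1) y - ray (grid R N i) y))%:E).
  apply/funext => y; rewrite /step_pow; congr EFin.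
  by apply: eq_bigr => i _; rewrite !addr0.
exact: (@integral_ray_sum R F F_nd F_ge0 _ (grid R N) (fun i => grid R N i ^+ n) (grid_le N)).
Qed.

Let cvg_step n (y : R) : step_pow n N 0 y @[N --> \oo] --> y ^+ n.
Proof.
apply: (@cvg_harmonic_bound _ _ (step_err R n).[y]) => N.
by apply: step_pow_approx; rewrite lexx invr_ge0 ler0n.
Qed.

Let mpow n : measurable_fun [set: measurableTypeR R] (fun y : measurableTypeR R => (y ^+ n)%:E).
Proof. by apply/measurable_EFinP; exact: measurable_funX. Qed.

(** Dominated convergence needs an integrable polynomial bound, so integrability must come first.
    For even exponents the step functions are nonnegative and their integrals converge to x_(2n), so
    Fatou's lemma applies; [pow_int] follows from |y^n| <= 1 + y^(2n). *)
Let even_int n : mu.-integrable setT (fun y : measurableTypeR R => (y ^+ (2 * n))%:E).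
Proof.
apply/integrableP; split; first exact: mpow.
have -> : (\int[mu]_y `|(y ^+ (2 * n))%:E| =
    \int[mu]_y limn_einf (fun N => (step_pow (2 * n) N 0 y)%:E))%E.
  apply: eq_integral => y _; rewrite gee0_abs; last first.
    by rewrite lee_fin exprM exprn_ge0 // sqr_ge0.
  apply/esym; apply: (cvg_limn_einf_sup _).1.
  by apply: cvg_EFin; [exact: nearW|exact: cvg_step].
apply: le_lt_trans (fatou _ _ _ _) _ => //.
- move=> N; exact: (measurable_int _ (step_int _ N).1).
- move=> N y _; rewrite lee_fin; apply: sumr_ge0 => i _; apply: mulr_ge0.
    by rewrite exprM exprn_ge0 // sqr_ge0.
  rewrite !addr0 /ray; case: ifPn => h1; case: ifPn => h2; rewrite ?subrr ?subr0 //.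
  by rewrite (le_trans h2 (grid_le _ _)) in h1.
- rewrite (_ : (fun N => _) = (fun N => (J (2 * n) N)%:E)); last first.
    by apply/funext => N; exact: (step_int _ _).2.
  have cJ : (fun N => (J (2 * n) N)%:E) @ \oo --> (x (2 * n))%:E.
    by apply: cvg_EFin; [exact: nearW|exact: cvgJ].
  by rewrite (cvg_limn_einf_sup cJ).1 ltey.
Qed.

Let pow_int n : mu.-integrable setT (fun y : measurableTypeR R => (y ^+ n)%:E).
Proof.
apply: (@le_integrable _ _ _ mu _ measurableT _
  (fun y => (y ^+ (2 * 0))%:E + (y ^+ (2 * n))%:E)%E) => //.
  move=> y _; rewrite -EFinD !abse_EFin lee_fin muln0 expr0.
  apply: le_trans (ler_norm _); rewrite mulnC exprM -real_normK ?num_real //.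
  by have := sqr_ge0 (`|y ^+ n| - 1); rewrite sqrrB1; have := normr_ge0 (y ^+ n); nra.
by apply: integrableD => //; exact: even_int.
Qed.

Let poly_int (q : {poly R}) : mu.-integrable setT (fun y : measurableTypeR R => q.[y]%:E).
Proof.
have -> : (fun y : measurableTypeR R => q.[y]%:E) =
    (fun y => \sum_(i < size q) (q`_i)%:E * (y ^+ i)%:E)%E.
  by apply/funext => y; rewrite horner_coef -sumEFin.
by apply: integrable_sum => // i _; apply: integrableZl => //; exact: pow_int.
Qed.

Lemma positive_extension_moment : is_moment_sequence x.
Proof.
exists mu => n; split; first exact: pow_int.
(* |step_pow| <= |y^n| + step_err, and |y^n| <= y^(2n) + 1 makes the bound a polynomial. *)
pose g : {poly R} := 'X^n * 'X^n + 1 + step_err R n.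
have dom N (y : R) : `|step_pow n N 0 y| <= g.[y].
  have h : `|y ^+ n - step_pow n N 0 y| <= (step_err R n).[y].
    have ap : `|y ^+ n - step_pow n N 0 y| <= (step_err R n).[y] / N.+1%:R.
      by apply: step_pow_approx; rewrite lexx invr_ge0 ler0n.
    apply: (le_trans ap).
    have := le_trans (normr_ge0 _) ap; rewrite pmulr_lge0 ?invr_gt0 ?ltr0n // => e0.
    by rewrite ler_pdivrMr ?ltr0n // ler_peMr // ler1n.
  rewrite /g !hornerD hornerM hornerXn hornerC.
  rewrite -(subKr (y ^+ n) (step_pow n N 0 y)).
  apply: le_trans (ler_normB _ _) _; apply: lerD => //.
  rewrite -expr2 -[(y ^+ n) ^+ 2]real_normK ?num_real //.
  by have := sqr_ge0 (`|y ^+ n| - 1); rewrite sqrrB1; have := normr_ge0 (y ^+ n); nra.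
have cv (y : R) : (step_pow n N 0 y)%:E @[N --> \oo] --> (y ^+ n)%:E.
  by apply: cvg_EFin; [exact: nearW|exact: cvg_step].
have cvae : {ae mu, forall y : measurableTypeR R, setT y ->
    (step_pow n N 0 y)%:E @[N --> \oo] --> (y ^+ n)%:E}.
  by apply: aeW => y _; exact: cv.
have domae : {ae mu, forall (y : measurableTypeR R) (N : nat), setT y ->
    (`|(step_pow n N 0 y)%:E| <= g.[y]%:E)%E}.
  by apply: aeW => y N _; rewrite abse_EFin lee_fin; exact: dom.
have [_ _ cI] := @dominated_convergence _ _ _ mu setT measurableT
  (fun N y => (step_pow n N 0 y)%:E) (fun y => (y ^+ n)%:E)
  (fun y => g.[y]%:E)
  (fun N => measurable_int _ (step_int n N).1) (mpow n)
  cvae (poly_int g) domae.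
apply: (cvg_unique _ cI) => //.
rewrite (_ : [sequence _]_n = (fun N => (J n N)%:E)); last first.
  by apply/funext => N; exact: (step_int _ _).2.
by apply: cvg_EFin; [exact: nearW|exact: cvgJ].
Qed.

End Hamburger.

Lemma hamburger (R : realType) (x : nat -> R) :
  (forall p, 0 <= momf x (p * p)) -> is_moment_sequence x.
Proof.
move=> psd; have Lpos := @scalar_nonneg_poly R (momf x) psd.
have [Lam [lin pos ext]] := riesz_extension Lpos.
exact: positive_extension_moment lin pos ext.
Qed.

(** * Permutations as words *)

(* Permutations as words over [0, ..., n - 1]; [grow l w] appends the letter [l] to
   [w] and renumbers the letters that are at least [l]. *)
Definition letters n (s : 'S_n) : seq nat := [seq val (s i) | i <- enum 'I_n].

Definition grow (l : nat) (w : seq nat) : seq nat := rcons (map (bump l) w) l.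

Section Words.
Local Open Scope nat_scope.

Lemma size_letters n (s : 'S_n) : size (letters s) = n.
Proof. by rewrite size_map size_enum_ord. Qed.

Lemma nth_letters n (s : 'S_n) (i : 'I_n) : nth 0 (letters s) i = s i.
Proof. by rewrite (nth_map i) ?size_enum_ord // nth_ord_enum. Qed.

Lemma uniq_letters n (s : 'S_n) : uniq (letters s).
Proof.
rewrite map_inj_uniq ?enum_uniq // => i j /val_inj; exact: perm_inj.
Qed.

Lemma mem_letters n (s : 'S_n) v : (v \in letters s) = (v < n).
Proof.
apply/mapP/idP; first by case=> i _ ->; exact: ltn_ord.
move=> vn; exists ((s^-1)%g (Ordinal vn)); first by rewrite mem_enum.
by rewrite permKV.
Qed.

Lemma letters_lift_perm n (l : 'I_n.+1) (s : 'S_n) :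
  letters (lift_perm ord_max l s) = grow l (letters s).
Proof.
rewrite /letters enum_ordSr map_rcons lift_perm_id /grow -!map_comp; congr rcons.
apply: eq_map => i /=.
have -> : widen_ord (leqnSn n) i = lift ord_max i.
  by apply: val_inj; rewrite /= /bump leqNgt ltn_ord.
by rewrite lift_perm_lift.
Qed.

End Words.

Lemma sum_perm_recr (A : nmodType) (G : seq nat -> A) n :
  \sum_(s : 'S_n.+1) G (letters s) =
  \sum_(s : 'S_n) \sum_(l < n.+1) G (grow l (letters s)).
Proof.
rewrite pair_big /=.
pose f (p : 'S_n * 'I_n.+1) := lift_perm ord_max p.2 p.1.
have f_inj : injective f.
  move=> [s l] [s' l'] /= e.
  have el : l = l'.
    rewrite -(lift_perm_id ord_max l s) -(lift_perm_id ord_max l' s').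
    by rewrite [lift_perm _ _ s]e.
  subst l'; congr pair; apply/permP => i.
  have := congr1 (fun t : 'S_n.+1 => t (lift ord_max i)) e.
  by rewrite /f /= !lift_perm_lift => /lift_inj.
have f_bij : bijective f.
  by apply: inj_card_bij => //; rewrite card_prod !card_Sn card_ord factS mulnC.
rewrite (reindex f) /=; last exact: onW_bij.
by apply: eq_bigr => p _; rewrite letters_lift_perm.
Qed.

Section Containment.
Local Open Scope nat_scope.

(* The bits [b01], [b02], [b12] are the outcomes of the comparisons of the letters
   of the pattern, [a1] and [a2] its adjacency requirements: 1-32, for instance, is
   [true true false false true]. *)
Variant contains (b01 b02 b12 a1 a2 : bool) (w : seq nat) : Prop :=
  Contains i j k of i < j & j < k & k < size w &
    (a1 -> j = i.+1) & (a2 -> k = j.+1) &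
    (nth 0 w i < nth 0 w j) = b01 & (nth 0 w i < nth 0 w k) = b02 &
    (nth 0 w j < nth 0 w k) = b12.

Definition av b01 b02 b12 a1 a2 w := `[< ~ contains b01 b02 b12 a1 a2 w >].

Definition av_count b01 b02 b12 a1 a2 n :=
  #|[set s : 'S_n | av b01 b02 b12 a1 a2 (letters s)]|.

Let o0 : 'I_3 := @Ordinal 3 0 isT.
Let o1 : 'I_3 := @Ordinal 3 1 isT.
Let o2 : 'I_3 := @Ordinal 3 2 isT.
Let d0 : 'I_3.-1 := @Ordinal 2 0 isT.
Let d1 : 'I_3.-1 := @Ordinal 2 1 isT.

Let ord3_ind (P : 'I_3 -> Prop) : P o0 -> P o1 -> P o2 -> forall i, P i.
Proof.
move=> h0 h1 h2 [[|[|[|//]]] h].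
- by rewrite (_ : Ordinal h = o0) //; apply: val_inj.
- by rewrite (_ : Ordinal h = o1) //; apply: val_inj.
- by rewrite (_ : Ordinal h = o2) //; apply: val_inj.
Qed.

Let ord2_ind (P : 'I_3.-1 -> Prop) : P d0 -> P d1 -> forall i, P i.
Proof.
move=> h0 h1 [[|[|//]] h].
- by rewrite (_ : Ordinal h = d0) //; apply: val_inj.
- by rewrite (_ : Ordinal h = d1) //; apply: val_inj.
Qed.

(** Of the nine comparisons in [occurrence] the diagonal ones are false, and those below the
    diagonal follow from the three above it since letters are distinct ([ltC]). *)
Lemma avoid_countE (p : pattern 3) n :
  avoid_count p n =
  av_count (word p o0 < word p o1) (word p o0 < word p o2)
    (word p o1 < word p o2) (d0 \notin dashes p) (d1 \notin dashes p) n.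
Proof.
have ltC m (t : 'S_m) (a b : 'I_m) : a != b -> (t b < t a) = ~~ (t a < t b).
  move=> ab; rewrite -leqNgt [RHS]leq_eqVlt (_ : (t b == t a :> nat) = false) //.
  by apply/negbTE; rewrite (inj_eq val_inj) (inj_eq perm_inj) eq_sym.
apply: eq_card => s; rewrite !inE; apply/idP/asboolP.
- move=> /existsP ex [i j k ij jk]; rewrite size_letters => kn h1 h2 h01 h02 h12.
  apply: ex.
  pose i' := Ordinal (ltn_trans ij (ltn_trans jk kn)).
  pose j' := Ordinal (ltn_trans jk kn).
  pose k' := Ordinal kn.
  have := (nth_letters s i', nth_letters s j', nth_letters s k') => /= -[[ei ej] ek].
  rewrite ei ej ek in h01 h02 h12.
  pose f : {ffun 'I_3 -> 'I_n} := [ffun a : 'I_3 =>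
    if val a is b.+1 then (if b is 0 then j' else k') else i'].
  have f0 : f o0 = i' by rewrite ffunE.
  have f1 : f o1 = j' by rewrite ffunE.
  have f2 : f o2 = k' by rewrite ffunE.
  have ji : i' != j' by rewrite neq_ltn ij.
  have kj : j' != k' by rewrite neq_ltn jk.
  have ki : i' != k' by rewrite neq_ltn (ltn_trans ij jk).
  exists f; apply/and3P; split; apply/forallP.
  + elim/ord3_ind; apply/forallP; elim/ord3_ind; apply/implyP => //= _;
    by rewrite ?f0 ?f1 ?f2 //= (ltn_trans ij jk).
  + have e01 : (s i' < s j') = (word p o0 < word p o1) by [].
    have e02 : (s i' < s k') = (word p o0 < word p o2) by [].
    have e12 : (s j' < s k') = (word p o1 < word p o2) by [].
    by elim/ord3_ind; apply/forallP; elim/ord3_ind;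
      rewrite ?f0 ?f1 ?f2 ?ltnn ?e01 ?e02 ?e12 ?eqxx // ltC // ?e01 ?e02 ?e12 -ltC.
  + elim/ord2_ind; apply/forallP; elim/ord3_ind; apply/forallP; elim/ord3_ind;
    rewrite ?andbF //= ?andbT; apply/implyP => hd; rewrite ?f0 ?f1 ?f2 /=.
      by rewrite h1.
    by rewrite h2.
- move=> nc; apply/existsP => -[f /and3P[/forallP inc /forallP ord /forallP adj]].
  apply: nc.
  have inc' a b := implyP (forallP (inc a) b).
  have ord' a b := eqP (forallP (ord a) b).
  have adj' d a b := implyP (forallP (forallP (adj d) a) b).
  exists (f o0) (f o1) (f o2); rewrite ?size_letters ?nth_letters //.
  + exact: inc'.
  + exact: inc'.
  + by move=> h; apply/eqP/(adj' d0 o0 o1); rewrite h.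
  + by move=> h; apply/eqP/(adj' d1 o1 o2); rewrite h.
Qed.

Let contains_compl b01 b02 b12 a1 a2 w w' : uniq w -> size w' = size w ->
  (forall i, i < size w -> nth 0 w i + nth 0 w' i = (size w).-1) ->
  contains b01 b02 b12 a1 a2 w -> contains (~~ b01) (~~ b02) (~~ b12) a1 a2 w'.
Proof.
move=> uw sw h [i j k ij jk kn h1 h2 h01 h02 h12].
have jn := ltn_trans jk kn; have inn := ltn_trans ij jn.
have nth_neq a b : a < size w -> b < size w -> a != b -> nth 0 w a != nth 0 w b.
  by move=> an bn ab; rewrite nth_uniq.
have := nth_neq i j inn jn; rewrite neq_ltn ij => /(_ isT) nij.
have := nth_neq j k jn kn; rewrite neq_ltn jk => /(_ isT) njk.
have := nth_neq i k inn kn; rewrite neq_ltn (ltn_trans ij jk) => /(_ isT) nik.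
have := (h i inn, h j jn, h k kn) => -[[ei ej] ek].
by exists i j k; rewrite ?sw // -?h01 -?h02 -?h12 -leqNgt; apply/idP/idP; lia.
Qed.

Let contains_rev b01 b02 b12 a1 a2 w w' : uniq w -> size w' = size w ->
  (forall i, i < size w -> nth 0 w' i = nth 0 w ((size w).-1 - i)) ->
  contains b01 b02 b12 a1 a2 w -> contains (~~ b12) (~~ b02) (~~ b01) a2 a1 w'.
Proof.
move=> uw sw h [i j k ij jk kn h1 h2 h01 h02 h12].
have jn := ltn_trans jk kn; have inn := ltn_trans ij jn.
have nth_neq a b : a < size w -> b < size w -> a != b -> nth 0 w a != nth 0 w b.
  by move=> an bn ab; rewrite nth_uniq.
have := nth_neq i j inn jn; rewrite neq_ltn ij => /(_ isT) nij.
have := nth_neq j k jn kn; rewrite neq_ltn jk => /(_ isT) njk.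
have := nth_neq i k inn kn; rewrite neq_ltn (ltn_trans ij jk) => /(_ isT) nik.
have e a : a < size w -> nth 0 w' ((size w).-1 - a) = nth 0 w a.
  by move=> an; rewrite h ?subKn //; lia.
exists ((size w).-1 - k) ((size w).-1 - j) ((size w).-1 - i);
  rewrite ?sw ?e // -?h01 -?h02 -?h12 -?leqNgt;
  try by apply/idP/idP; lia.
all: rewrite ?sw; clear h01 h02 h12 nij njk nik.
all: move: ij jk kn h1 h2; clear; move: (size w) => m ij jk kn h1 h2.
all: first [lia|by move=> /h2; lia|by move=> /h1; lia].
Qed.

Lemma av_count_compl b01 b02 b12 a1 a2 n :
  av_count (~~ b01) (~~ b02) (~~ b12) a1 a2 n = av_count b01 b02 b12 a1 a2 n.
Proof.
pose r : 'S_n := perm (@rev_ord_inj n).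
rewrite /av_count -!sum1dep_card (reindex_inj (mulIg r)) /=.
apply: eq_bigl => s.
have e i : i < n -> nth 0 (letters s) i + nth 0 (letters (s * r)%g) i = n.-1.
  move=> hi; rewrite (nth_letters s (Ordinal hi)) (nth_letters (s * r)%g (Ordinal hi)).
  by rewrite permM permE /=; have := ltn_ord (s (Ordinal hi)); lia.
apply/asboolP/asboolP; apply: contra_not => c.
  apply: (contains_compl (uniq_letters s)) c; rewrite ?size_letters //.
rewrite -[b01]negbK -[b02]negbK -[b12]negbK.
apply: (contains_compl (uniq_letters (s * r)%g)) c; rewrite ?size_letters // => i hi.
by rewrite addnC e.
Qed.

Lemma av_count_rev b01 b02 b12 a1 a2 n :
  av_count (~~ b12) (~~ b02) (~~ b01) a2 a1 n = av_count b01 b02 b12 a1 a2 n.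
Proof.
pose r : 'S_n := perm (@rev_ord_inj n).
rewrite /av_count -!sum1dep_card (reindex_inj (mulgI r)) /=.
apply: eq_bigl => s.
have e i : i < n -> nth 0 (letters (r * s)%g) i = nth 0 (letters s) (n.-1 - i).
  move=> hi; have hr : n.-1 - i < n by lia.
  rewrite (nth_letters s (Ordinal hr)) (nth_letters (r * s)%g (Ordinal hi)).
  rewrite permM permE; congr (nat_of_ord (s _)); apply: val_inj => /=; lia.
apply/asboolP/asboolP; apply: contra_not => c.
  apply: (contains_rev (uniq_letters s)) c; rewrite ?size_letters //.
rewrite -[b01]negbK -[b02]negbK -[b12]negbK.
apply: (contains_rev (uniq_letters (r * s)%g)) c; rewrite ?size_letters // => i hi.
by rewrite e ?subKn //; lia.
Qed.

End Containment.

Section Append.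
Local Open Scope nat_scope.

(** The occurrences created by appending l, which plays the last letter of the pattern. Comparisons
    with l may use the letters before renumbering, because [bump l x < l] exactly when [x < l]. *)
Variant completes (b01 b02 b12 a1 a2 : bool) (l : nat) (w : seq nat) : Prop :=
  Ends i j of i < j & j < size w & (a1 -> j = i.+1) & (a2 -> size w = j.+1) &
    (nth 0 w i < nth 0 w j) = b01 & (nth 0 w i < l) = b02 &
    (nth 0 w j < l) = b12.

Lemma size_grow l w : size (grow l w) = (size w).+1.
Proof. by rewrite size_rcons size_map. Qed.

Lemma nth_grow l w i :
  nth 0 (grow l w) i = if i < size w then bump l (nth 0 w i) else
    if i == size w then l else 0.
Proof.
rewrite nth_rcons size_map; case: ltnP => // h.
by rewrite (nth_map 0).
Qed.

Lemma last_grow l w d : last d (grow l w) = l.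
Proof. by rewrite last_rcons. Qed.

Lemma ltn_bump2 l x y : (bump l x < bump l y) = (x < y).
Proof. by rewrite !ltnNge leq_bump2. Qed.

Lemma bump_lt l x : (bump l x < l) = (x < l).
Proof. by rewrite /bump; case: leqP => h; lia. Qed.

Lemma contains_grow b01 b02 b12 a1 a2 l w :
  contains b01 b02 b12 a1 a2 (grow l w) <->
  contains b01 b02 b12 a1 a2 w \/ completes b01 b02 b12 a1 a2 l w.
Proof.
split.
- case=> i j k ij jk; rewrite size_grow ltnS leq_eqVlt => /predU1P[kE|kn] h1 h2;
    rewrite !nth_grow.
    have jn : j < size w by rewrite -kE.
    have inn := ltn_trans ij jn.
    rewrite jn inn kE ltnn eqxx ltn_bump2 !bump_lt => h01 h02 h12.
    by right; exists i j => //; rewrite -kE.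
  have jn := ltn_trans jk kn; have inn := ltn_trans ij jn.
  rewrite kn jn inn !ltn_bump2 => h01 h02 h12.
  by left; exists i j k.
- case=> [[i j k ij jk kn h1 h2 h01 h02 h12]|[i j ij jn h1 h2 h01 h02 h12]].
    have jn := ltn_trans jk kn; have inn := ltn_trans ij jn.
    by exists i j k; rewrite ?size_grow ?nth_grow ?kn ?jn ?inn ?ltn_bump2 // ltnW.
  have inn := ltn_trans ij jn.
  by exists i j (size w); rewrite ?size_grow ?nth_grow ?jn ?inn ?ltnn ?eqxx ?ltn_bump2 ?bump_lt.
Qed.

Lemma av_grow b01 b02 b12 a1 a2 l w :
  av b01 b02 b12 a1 a2 (grow l w) =
  av b01 b02 b12 a1 a2 w && ~~ `[< completes b01 b02 b12 a1 a2 l w >].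
Proof.
apply/asboolP/andP => [h|[/asboolP h1 /asboolP h2]].
  by split; apply/asboolP => c; apply: h; apply/contains_grow; [left|right].
by move/contains_grow => [].
Qed.

End Append.

Section AvoiderSums.
Variables (R : comNzRingType) (b01 b02 b12 a1 a2 : bool).

Local Notation av := (av b01 b02 b12 a1 a2).
Local Notation completes := (completes b01 b02 b12 a1 a2).

Definition avsum n (G : seq nat -> R) : R := \sum_(s : 'S_n | av (letters s)) G (letters s).

Lemma avsum1 n : (av_count b01 b02 b12 a1 a2 n)%:R = avsum n (fun=> 1).
Proof. by rewrite /avsum sumr_const /av_count cardsE. Qed.

Lemma eq_avsum n G G' : (forall s : 'S_n, av (letters s) -> G (letters s) = G' (letters s)) ->
  avsum n G = avsum n G'.
Proof. exact: eq_bigr. Qed.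

Lemma avsumS n G : avsum n.+1 G =
  avsum n (fun w => \sum_(l < n.+1 | ~~ `[< completes l w >]) G (grow l w)).
Proof.
rewrite /avsum big_mkcond /=.
rewrite (sum_perm_recr (fun w => if av w then G w else 0)) [RHS]big_mkcond.
apply: eq_bigr => s _.
transitivity (\sum_(l < n.+1) (if av (letters s) && ~~ `[< completes l (letters s) >]
    then G (grow l (letters s)) else 0)).
  by apply: eq_bigr => l _; rewrite -av_grow.
case: ifP => h /=; last by rewrite big1.
by rewrite -big_mkcond.
Qed.

Lemma avsum0 G : avsum 0 G = G [::].
Proof.
have e (s : 'S_0) : letters s = [::] by apply/size0nil/size_letters.
rewrite /avsum (big_pred1 1%g) ?e // => s; rewrite e.
have -> : s = 1%g by apply/permP => -[].
by rewrite /= eqxx; apply/asboolP => -[i j k _ _ /=]; rewrite ltn0.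
Qed.

Lemma avsumB n G G' : avsum n (fun w => G w - G' w) = avsum n G - avsum n G'.
Proof. exact: sumrB. Qed.

(* [last 0 w] is the last letter; it is only used for nonempty words. *)
Lemma avsum_last n (G : seq nat -> R) m :
  avsum n.+1 (fun w => ((last 0%N w < m)%N)%:R * G w) =
  \sum_(l < m) avsum n.+1 (fun w => (last 0%N w == l)%:R * G w).
Proof.
rewrite /avsum exchange_big /=; apply: eq_bigr => s _.
rewrite -mulr_suml; congr (_ * _); case: ltnP => h.
  rewrite (bigD1 (Ordinal h)) //= eqxx big1 ?addr0 // => i.
  by rewrite -val_eqE eq_sym /= => /negbTE ->.
by rewrite big1 // => i _; rewrite gtn_eqF // (leq_trans (ltn_ord i) h).
Qed.

Lemma avsum_total n (G : seq nat -> R) :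
  avsum n.+1 G = \sum_(l < n.+1) avsum n.+1 (fun w => (last 0%N w == l)%:R * G w).
Proof.
rewrite -avsum_last; apply: eq_avsum => s _; rewrite -{1}[G _]mul1r; congr (_ * _).
suff -> : (last 0%N (letters s) < n.+1)%N by [].
have := mem_last 0%N (letters s).
by rewrite inE mem_letters => /orP[/eqP->|].
Qed.

End AvoiderSums.

Lemma sum_binom (R : pzSemiRingType) (m k : nat) :
  \sum_(i < m) ('C(i, k))%:R = ('C(m, k.+1))%:R :> R.
Proof.
elim: m => [|m IH]; first by rewrite big_ord0.
by rewrite big_ord_recr IH /= -natrD binS addnC.
Qed.

(** * Catalan numbers *)

Section Catalan.
Variables (R : comNzRingType) (b01 b02 b12 a1 a2 : bool).

Local Notation av := (av b01 b02 b12 a1 a2).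
Local Notation completes := (completes b01 b02 b12 a1 a2).

Definition catalan_al (n : nat) : R := if n is 0 then 1 else 2.
Definition catalan_be (n : nat) : R := 1.

(* Catalan generating tree: an avoider [w] accepts exactly the letters
   [0, ..., m w], and the statistic [m] takes the values [1, ..., m w + 1] on its
   children. *)
Lemma av_count_catalan (m : seq nat -> nat) :
  m [::] = 0%N ->
  (forall n (s : 'S_n), av (letters s) -> (m (letters s) <= n)%N) ->
  (forall n (s : 'S_n) (l : nat), av (letters s) -> (l <= n)%N ->
     (completes l (letters s) <-> (m (letters s) < l)%N)) ->
  (forall n (s : 'S_n) (g : nat -> R), av (letters s) ->
     \sum_(l < (m (letters s)).+1) g (m (grow l (letters s))) =
     \sum_(l < (m (letters s)).+1) g l.+1) ->
  forall n, (av_count b01 b02 b12 a1 a2 n)%:R = jfrac catalan_al catalan_be n.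
Proof.
move=> m0 mle endsP child n; rewrite jfrac_motz avsum1.
(* Binomial moments of m over the avoiders are the path sums. The values 1, ..., m + 1 on the
   children give C(m+2,k+1) - C(0,k), which is C(m,k-1) + 2 C(m,k) + C(m,k+1) for k > 0 and 1 + m
   for k = 0. *)
have key k : avsum b01 b02 b12 a1 a2 n (fun w => ('C(m w, k))%:R) =
    motz catalan_al catalan_be n k.
  elim: n k => [|n IH] k; first by rewrite avsum0 m0 bin0n.
  rewrite avsumS motzS.
  have step (s : 'S_n) : av (letters s) ->
     \sum_(l < n.+1 | ~~ `[< completes l (letters s) >]) ('C(m (grow l (letters s)), k))%:R =
     (if k is j.+1 then ('C(m (letters s), j))%:R else 0) +
     catalan_al k * ('C(m (letters s), k))%:R + ('C(m (letters s), k.+1))%:R :> R.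
    move=> avs; have mn := mle _ _ avs.
    transitivity (\sum_(l < n.+1 | (l < (m (letters s)).+1)%N)
      ('C(m (grow l (letters s)), k))%:R : R).
      apply: eq_bigl => l; rewrite ltnS leqNgt; congr negb.
      have e := endsP _ _ l avs (ltn_ord l).
      by apply/asboolP/idP => /e.
    rewrite -(big_ord_widen n.+1 (fun l => ('C(m (grow l (letters s)), k))%:R)) //.
    rewrite (child _ _ (fun x => ('C(x, k))%:R)) //.
    have := sum_binom R (m (letters s)).+2 k; rewrite big_ord_recl /= /bump /=.
    move=> e; under eq_bigr => l _ do rewrite -add1n.
    case: k e => [|k] e.
      apply: (addrI ('C(0, 0))%:R); rewrite e !binS !bin0 !bin1 /catalan_al.
      by rewrite !natrD; ring.
    apply: (addrI ('C(0, k.+1))%:R); rewrite e bin0n add0r !binS !natrD /catalan_al.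
    by ring.
  transitivity (avsum b01 b02 b12 a1 a2 n (fun w =>
     (if k is j.+1 then ('C(m w, j))%:R else 0) +
     catalan_al k * ('C(m w, k))%:R + ('C(m w, k.+1))%:R : R)).
    by apply: eq_avsum => s; exact: step.
  rewrite /avsum !big_split /= -big_distrr -!IH /= mul1r.
  by case: k {step} => [|k]; [rewrite [X in X + _ * _]big1|rewrite -IH].
by rewrite -key; apply: eq_avsum => s _; rewrite bin0.
Qed.

End Catalan.

Section CatalanClasses.
Variable R : comNzRingType.

(** t is the larger letter of an inversion (here) or of a non-inversion ([top123]). A new last
    letter completes the pattern exactly when it exceeds some such t. *)
Definition top213 (w : seq nat) (t : nat) : Prop :=
  exists i j, [/\ (i < j)%N, (j < size w)%N, nth 0%N w i = t & (nth 0%N w j < t)%N].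

Definition top123 (w : seq nat) (t : nat) : Prop :=
  exists i j, [/\ (i < j)%N, (j < size w)%N, nth 0%N w j = t & (nth 0%N w i < t)%N].

(** The default [size w], when no letter satisfies P, is the right value: every new letter is then
    accepted. *)
Definition mintop (P : seq nat -> nat -> Prop) (w : seq nat) : nat :=
  find (fun t => `[< P w t >]) (iota 0 (size w)).

Lemma mintop_le P w : (mintop P w <= size w)%N.
Proof. by apply: leq_trans (find_size _ _) _; rewrite size_iota. Qed.

Lemma mintop_lt P w t : (t < mintop P w)%N -> ~ P w t.
Proof.
move=> h; have := before_find 0%N h; rewrite nth_iota ?add0n.
  by move/negbT/asboolPn.
exact: leq_trans h (mintop_le P w).
Qed.

Lemma mintopP P w : (mintop P w < size w)%N -> P w (mintop P w).
Proof.
move=> h; have hs : has (fun t => `[< P w t >]) (iota 0 (size w)).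
  by rewrite has_find size_iota.
by have := nth_find 0%N hs; rewrite nth_iota // add0n => /asboolP.
Qed.

Lemma mintop_unique P w m : (m <= size w)%N -> (forall t, (t < m)%N -> ~ P w t) ->
  ((m < size w)%N -> P w m) -> mintop P w = m.
Proof.
move=> mle h1 h2; apply/eqP; rewrite eqn_leq; apply/andP; split; rewrite leqNgt.
- apply/negP => h; apply: (mintop_lt h); apply: h2.
  exact: leq_trans h (mintop_le P w).
- apply/negP => h; apply: (h1 _ h); apply: mintopP.
  exact: leq_trans h mle.
Qed.

Lemma ltn_mintop P w l : (l <= size w)%N ->
  (mintop P w < l)%N <-> exists t, (t < l)%N /\ P w t.
Proof.
move=> lw; split=> [h|[t [tl Pt]]].
  by exists (mintop P w); split=> //; apply: mintopP; exact: leq_trans h lw.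
apply: leq_trans tl; rewrite ltnS leqNgt; apply/negP => h.
exact: mintop_lt h Pt.
Qed.

Lemma index_letters n (s : 'S_n) v : (v < n)%N ->
  exists2 i, (i < n)%N & nth 0%N (letters s) i = v.
Proof.
rewrite -(mem_letters s) => vw; exists (index v (letters s)); last exact: nth_index.
by rewrite -index_mem size_letters in vw.
Qed.

Lemma av_count_213 n :
  (av_count false true true false false n)%:R =
  jfrac (@catalan_al R) (@catalan_be R) n.
Proof.
apply: (@av_count_catalan _ _ _ _ _ _ (mintop top213)) => // {n}.
- by move=> n s _; rewrite -{2}(size_letters s) mintop_le.
- move=> n s l _; rewrite -{1}(size_letters s) => ln.
  rewrite ltn_mintop //; split.
    case=> i j ij jn _ _ h01 h02 h12; exists (nth 0%N (letters s) i); split=> //.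
    exists i, j; split=> //.
    have : nth 0%N (letters s) i != nth 0%N (letters s) j.
      by rewrite nth_uniq ?uniq_letters ?(ltn_trans ij jn) // neq_ltn ij.
    by rewrite neq_ltn h01.
  case=> t [tl [i [j [ij jn ti ji]]]]; exists i j => //; rewrite ?ti //.
    by apply/negbTE; rewrite -leqNgt ltnW.
  exact: ltn_trans ji tl.
(* Appending l <= m makes the letter now equal to l + 1 an inversion top, if there is one, and all
   older tops move to l + 1 or above; hence the statistic becomes l + 1. *)
- move=> n s g _; apply: eq_bigr => l _; congr g.
  have szn := size_letters s; have mn := mintop_le top213 (letters s).
  have lm : (l <= mintop top213 (letters s))%N by rewrite -ltnS ltn_ord.
  have ln : (l <= n)%N by have := leq_trans lm mn; rewrite szn.
  apply: mintop_unique; rewrite ?size_grow ?szn //.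
  + move=> t tl [i [j [ij]]]; rewrite size_grow ltnS leq_eqVlt.
    move=> /predU1P[jE|jn]; rewrite !nth_grow.
      rewrite jE ltnn eqxx -jE ij => e; rewrite -e in tl *.
      by move: tl; rewrite /bump; case: leqP; lia.
    rewrite jn (ltn_trans ij jn) => e; rewrite -e ltn_bump2 => ji.
    have : ~ (nth 0%N (letters s) i < mintop top213 (letters s))%N.
      by move=> /mintop_lt; apply; exists i, j.
    by move: tl; rewrite -e /bump; case: leqP; lia.
  + rewrite ltnS => /(index_letters s)[i hi ei].
    exists i, n; rewrite size_grow !nth_grow szn hi ltnn eqxx ei /bump !leqnn.
    by split.
Qed.

Lemma av_count_123 n :
  (av_count true true true false false n)%:R =
  jfrac (@catalan_al R) (@catalan_be R) n.
Proof.
apply: (@av_count_catalan _ _ _ _ _ _ (mintop top123)) => // {n}.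
- by move=> n s _; rewrite -{2}(size_letters s) mintop_le.
- move=> n s l _; rewrite -{1}(size_letters s) => ln.
  rewrite ltn_mintop //; split.
    by case=> i j ij jn _ _ h01 h02 h12; exists (nth 0%N (letters s) j); split=> //; exists i, j.
  case=> t [tl [i [j [ij jn ti ji]]]]; exists i j => //; rewrite ?ti //.
  exact: ltn_trans ji tl.
(* The letter 0 is no top and shifts the old minimum to m + 1; a letter l > 0 becomes the least top,
   preceded by 0. The values 1, ..., m + 1 appear in cyclically shifted order. *)
- move=> n s g _; rewrite big_ord_recl big_ord_recr addrC /=.
  have szn := size_letters s; have mn := mintop_le top123 (letters s).
  have le_top i j : (i < j)%N -> (j < size (letters s))%N ->
      (nth 0%N (letters s) i < nth 0%N (letters s) j)%N ->
      (mintop top123 (letters s) <= nth 0%N (letters s) j)%N.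
    move=> ij jn lt; rewrite leqNgt; apply/negP => /mintop_lt; apply.
    by exists i, j.
  congr (_ + _); last first.
    congr g; apply: mintop_unique; rewrite ?size_grow ?ltnS //.
    + move=> t tl [i [j [ij]]]; rewrite size_grow ltnS leq_eqVlt.
      move=> /predU1P[jE|jn]; rewrite !nth_grow.
        by rewrite jE ltnn eqxx => <-.
      rewrite jn (ltn_trans ij jn) => e; rewrite -e ltn_bump2 => ji.
      have := le_top _ _ ij jn ji; move: tl; rewrite -e /bump; case: leqP; lia.
    + move=> h; have [i [j [ij jn e ji]]] := mintopP h.
      exists i, j; rewrite size_grow !nth_grow jn (ltn_trans ij jn) ltn_bump2 e /bump.
      by split=> //; exact: leqW.
  apply: eq_bigr => l _; congr g; rewrite /bump /= add1n.
  have lm : (l.+1 <= mintop top123 (letters s))%N by rewrite ltn_ord.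
  have ln : (l.+1 <= n)%N by have := leq_trans lm mn; rewrite szn.
  apply: mintop_unique; rewrite ?size_grow ?szn //; first exact: leqW.
  + move=> t tl [i [j [ij]]]; rewrite size_grow ltnS leq_eqVlt.
    move=> /predU1P[jE|jn]; rewrite !nth_grow.
      by rewrite jE ltnn eqxx => e; move: tl; rewrite e ltnn.
    rewrite jn (ltn_trans ij jn) => e; rewrite -e ltn_bump2 => ji.
    have := le_top _ _ ij jn ji; move: tl; rewrite -e /bump; case: leqP; lia.
  + move=> _; have [i hi ei] := index_letters s (leq_ltn_trans (leq0n _) ln).
    exists i, n; rewrite size_grow !nth_grow szn hi ltnn eqxx ei.
    by split.
Qed.

(* Between the two larger letters some adjacent pair crosses the level of the
   first letter. *)
Lemma contains_213_adjacent w : uniq w ->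
  contains false true true false false w -> contains false true true false true w.
Proof.
move=> uw [i j k ij jk kn _ _ h01 h02 h12].
have [d] := ubnP (k - j); elim: d j ij jk h01 h12 => [//|d IH] j ij jk h01 h12 hd.
have [E|NE] := eqVneq k j.+1; first by exists i j k.
have jk1 : (j.+1 < k)%N by rewrite ltn_neqAle eq_sym NE.
have : nth 0%N w j.+1 != nth 0%N w i.
  by rewrite nth_uniq ?(ltn_trans jk1) ?(ltn_trans ij (ltn_trans jk kn)) // gtn_eqF // leqW.
rewrite neq_ltn => /orP[lt|gt].
  apply: (IH j.+1) => //; first exact: leqW.
  - by apply/negbTE; rewrite -leqNgt ltnW.
  - exact: ltn_trans lt h02.
  - by move: hd jk1; clear; lia.
exists i j j.+1 => //; first exact: ltn_trans jk1 kn.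
apply: leq_ltn_trans gt.
by rewrite leqNgt h01.
Qed.

Lemma av_count_213_adjacent n :
  av_count false true true false true n = av_count false true true false false n.
Proof.
apply: eq_card => s; rewrite !inE; apply/asboolP/asboolP; apply: contra_not.
  exact/contains_213_adjacent/uniq_letters.
by case=> i j k *; exists i j k.
Qed.

End CatalanClasses.

(** * Bell numbers *)

Section LastLetter.
Variables (R : comNzRingType) (b01 b02 b12 a1 a2 : bool).

Local Notation av := (av b01 b02 b12 a1 a2).
Local Notation completes := (completes b01 b02 b12 a1 a2).
Local Notation avsum := (@avsum R b01 b02 b12 a1 a2).

Definition avlast n l : R := avsum n (fun w => (last 0%N w == l)%:R).

Lemma avsum_grow n l G : (l <= n)%N ->
  avsum n.+1 (fun w => (last 0%N w == l)%:R * G w) =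
  avsum n (fun w => (~~ `[< completes l w >])%:R * G (grow l w)).
Proof.
move=> ln; rewrite avsumS; apply: eq_bigr => s _.
rewrite big_mkcond (bigD1 (Ordinal (ln : (l < n.+1)%N))) //= big1 ?addr0.
  by rewrite last_grow eqxx mul1r; case: ifP => _; rewrite ?mul1r ?mul0r.
move=> i; rewrite -val_eqE /= last_grow => /negbTE ->.
by rewrite mul0r if_same.
Qed.

Lemma avlast_grow n l : (l <= n)%N ->
  avlast n.+1 l = avsum n (fun w => (~~ `[< completes l w >])%:R).
Proof.
move=> ln; transitivity (avsum n.+1 (fun w => (last 0%N w == l)%:R * 1)).
  by apply: eq_avsum => s _; rewrite mulr1.
by rewrite avsum_grow //; apply: eq_avsum => s _; rewrite mulr1.
Qed.

Lemma avlast_lt n m :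
  avsum n.+1 (fun w => (last 0%N w < m)%N%:R) = \sum_(l < m) avlast n.+1 l.
Proof.
transitivity (avsum n.+1 (fun w => (last 0%N w < m)%N%:R * 1)).
  by apply: eq_avsum => s _; rewrite mulr1.
rewrite avsum_last; apply: eq_bigr => l _.
by apply: eq_avsum => s _; rewrite mulr1.
Qed.

Lemma avlast_total n :
  (av_count b01 b02 b12 a1 a2 n.+1)%:R = \sum_(l < n.+1) avlast n.+1 l.
Proof.
rewrite avsum1 avsum_total; apply: eq_bigr => l _.
by apply: eq_avsum => s _; rewrite mulr1.
Qed.

Lemma avlast1 : avlast 1 0 = (av_count b01 b02 b12 a1 a2 0)%:R.
Proof.
rewrite avlast_grow // avsum1 !avsum0.
by case: asboolP => // -[i j _ /=].
Qed.

End LastLetter.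

Section LastLetterWords.

Lemma last_letters n (s : 'S_n.+1) : last 0%N (letters s) = nth 0%N (letters s) n.
Proof. by rewrite -nth_last size_letters. Qed.

Lemma before_last n (s : 'S_n.+1) v : (v <= n)%N -> v != last 0%N (letters s) ->
  exists2 i, (i < n)%N & nth 0%N (letters s) i = v.
Proof.
move=> vn ne; have [i hi ei] := index_letters s (vn : (v < n.+1)%N).
exists i => //; move: hi; rewrite ltnS leq_eqVlt => /predU1P[iE|//].
by move: ne; rewrite last_letters -ei iE eqxx.
Qed.

End LastLetterWords.

Section BellClasses.
Variable R : comNzRingType.

(** If any letter can play the 1 of the pattern, the letter 0 can; only the last two letters then
    matter. *)
Lemma completes_1_32 n (s : 'S_n.+1) l :
  `[< completes true true false false true l (letters s) >] =
  (0 < l <= last 0%N (letters s))%N.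
Proof.
rewrite last_letters; apply/asboolP/andP.
  case=> i j ij _ _ /(_ isT); rewrite size_letters => -[nj].
  subst j => _ il /negbT.
  by rewrite -leqNgt; split=> //; exact: leq_ltn_trans il.
move=> [l0 ll]; have [||i hi ei] := @before_last n s 0; rewrite ?last_letters //.
  by rewrite ltn_eqF // (leq_trans l0 ll).
exists i n; rewrite ?size_letters ?ei //; first exact: leq_trans l0 ll.
by apply/negbTE; rewrite -leqNgt.
Qed.

Lemma completes_1_23 n (s : 'S_n.+1) l :
  `[< completes true true true false true l (letters s) >] =
  (0 < last 0%N (letters s) < l)%N.
Proof.
rewrite last_letters; apply/asboolP/andP.
  case=> i j ij _ _ /(_ isT); rewrite size_letters => -[nj].
  subst j => ij' _ jl.
  by split=> //; exact: leq_ltn_trans ij'.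
move=> [l0 ll]; have [||i hi ei] := @before_last n s 0; rewrite ?last_letters //.
  by rewrite ltn_eqF.
by exists i n; rewrite ?size_letters ?ei //; exact: leq_ltn_trans ll.
Qed.

Local Notation x := (fun n => (av_count true true false false true n)%:R : R).
Local Notation y := (fun n => (av_count true true true false true n)%:R : R).

(** Bell recurrence. The final letter l + 1 is accepted exactly when the previous one is at most l,
    so rows indexed by the last letter are partial sums of the preceding row, and iterated partial
    sums give binomial coefficients. *)
Lemma av_count_1_32 n : x n.+1 = \sum_(i < n.+1) 'C(n, i)%:R * x (n - i)%N.
Proof.
pose a := @avlast R true true false false true.
have a0 m : a m.+1 0%N = x m.
  case: m => [|m]; first exact: avlast1.
  rewrite /a avlast_grow // avsum1; apply: eq_avsum => s _.
  by rewrite completes_1_32.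
have aS m l : (l <= m)%N -> a m.+2 l.+1 = \sum_(k < l.+1) a m.+1 k.
  move=> lm; rewrite /a avlast_grow // -avlast_lt; apply: eq_avsum => s _.
  by rewrite completes_1_32 //= -ltnNge.
have aE m l : (l <= m)%N ->
    a m.+2 l.+1 = \sum_(i < m.+1) 'C(l, i)%:R * x (m - i)%N.
  elim: m l => [|m IH] l lm.
    move: lm; rewrite leqn0 => /eqP ->.
    by rewrite aS // !big_ord1 a0 bin0 mul1r.
  rewrite aS // big_ord_recl a0 [RHS]big_ord_recl bin0 mul1r subn0; congr (_ + _).
  transitivity (\sum_(k < l) \sum_(i < m.+1) 'C(k, i)%:R * x (m - i)%N).
    apply: eq_bigr => k _; rewrite /= /bump /= add1n IH //.
    by rewrite -ltnS; exact: leq_trans (ltn_ord k) lm.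
  rewrite exchange_big; apply: eq_bigr => i _ /=.
  by rewrite -mulr_suml sum_binom.
case: n => [|n]; first by rewrite big_ord1 avlast_total big_ord1 -/a a0 mul1r.
rewrite avlast_total big_ord_recl -/a a0 [RHS]big_ord_recl bin0 mul1r subn0.
congr (_ + _).
transitivity (\sum_(k < n.+1) \sum_(i < n.+1) 'C(k, i)%:R * x (n - i)%N).
  by apply: eq_bigr => k _; rewrite /= /bump /= add1n aE // -ltnS.
rewrite exchange_big; apply: eq_bigr => i _ /=.
by rewrite -mulr_suml sum_binom.
Qed.

(** Here the letters 1, ..., l are the forbidden predecessors of l + 1, so partial sums enter with a
    minus sign and the Bell recurrence comes out binomially inverted. The term i = n + 1 is 0. *)
Lemma av_count_1_23 n :
  \sum_(i < n.+2) (-1) ^+ i * 'C(n, i)%:R * y (n.+1 - i)%N = y n.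
Proof.
pose a := @avlast R true true true false true.
have a0 m : a m.+1 0%N = y m.
  case: m => [|m]; first exact: avlast1.
  rewrite /a avlast_grow // avsum1; apply: eq_avsum => s _.
  by rewrite completes_1_23 // ltn0 andbF.
have aS m l : (l <= m)%N ->
    a m.+2 l.+1 = y m.+1 - \sum_(k < l) a m.+1 k.+1.
  move=> lm; rewrite /a avlast_grow // -[\sum_(k < l) _](addKr (a m.+1 0%N)).
  have := avlast_lt R true true true false true m l.+1.
  rewrite big_ord_recl => <-; rewrite opprD opprK addrCA addrC.
  rewrite avsum1 -avsumB /a /avlast /avsum -big_split /=; apply: eq_bigr => s _.
  rewrite completes_1_23 //; case: (last 0%N _) => [|k] /=.
    by rewrite subrr add0r.
  by rewrite addr0 ltnS; case: ltnP; rewrite ?subrr ?subr0.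
have aE m l : (l <= m)%N ->
    a m.+2 l.+1 = \sum_(i < m.+2) (-1) ^+ i * 'C(l, i)%:R * y (m.+1 - i)%N.
  elim: m l => [|m IH] l lm.
    move: lm; rewrite leqn0 => /eqP ->.
    rewrite aS // big_ord0 subr0 !big_ord_recl big_ord0 /= /bump /=.
    by rewrite !mul1r mulr0 mul0r !addr0.
  rewrite aS // [RHS]big_ord_recl bin0 !mul1r subn0; congr (_ + _).
  rewrite -sumrN.
  transitivity (\sum_(k < l) \sum_(i < m.+2)
      - ((-1) ^+ i * 'C(k, i)%:R * y (m.+1 - i)%N)).
    apply: eq_bigr => k _; rewrite IH ?sumrN //.
    by rewrite -ltnS; exact: leq_trans (ltn_ord k) lm.
  rewrite exchange_big; apply: eq_bigr => i _ /=.
  rewrite sumrN -mulr_suml -mulr_sumr sum_binom /bump /= add1n exprS subSS.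
  by rewrite !mulN1r !mulNr.
case: n => [|n].
  rewrite !big_ord_recl big_ord0 /= /bump /= !mul1r mulr0 mul0r !addr0.
  by rewrite avlast_total big_ord1 -/a a0.
have := avlast_total R true true true false true n.+1.
rewrite big_ord_recl -/a a0 [LHS in _ -> LHS = _]big_ord_recl.
rewrite bin0 !mul1r subn0 => ->; rewrite -[RHS]addr0 -addrA; congr (_ + _).
rewrite (eq_bigr (fun k : 'I_n.+1 => \sum_(i < n.+2)
   (-1) ^+ i * 'C(k, i)%:R * y (n.+1 - i)%N)); last first.
  by move=> k _; rewrite /= /bump /= add1n aE // -ltnS.
rewrite exchange_big -big_split big1 // => i _ /=.
rewrite -mulr_suml -mulr_sumr sum_binom /bump /= add1n exprS subSS.
by rewrite !mulN1r !mulNr subrr.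
Qed.

End BellClasses.

(** * Consecutive patterns *)

Section Consecutive.
Variable R : comNzRingType.

(* The letter before the last one; junk on words of length less than 2. *)
Definition penult (w : seq nat) : nat := nth 0%N w (size w).-2.

Definition asc (w : seq nat) : bool :=
  (1 < size w)%N && (penult w < last 0%N w)%N.

Lemma penult_grow l w : (0 < size w)%N ->
  penult (grow l w) = bump l (last 0%N w).
Proof.
move=> h; rewrite /penult size_grow nth_grow /= -nth_last.
by rewrite prednK ?leqnn.
Qed.

Lemma asc_grow n (s : 'S_n.+1) l : asc (grow l (letters s)) = (last 0%N (letters s) < l)%N.
Proof.
rewrite /asc size_grow size_letters penult_grow ?size_letters // last_grow bump_lt.
by [].
Qed.

Lemma completes_consecutive b01 b02 b12 n (s : 'S_n.+1) l :
  `[< completes b01 b02 b12 true true l (letters s) >] =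
  [&& (0 < n)%N, (penult (letters s) < last 0%N (letters s))%N == b01,
    (penult (letters s) < l)%N == b02 & (last 0%N (letters s) < l)%N == b12].
Proof.
rewrite /penult last_letters size_letters /=; apply/asboolP/and4P.
  case=> i j _ _ /(_ isT) -> /(_ isT); rewrite size_letters => -[ni].
  by subst n => /= -> -> ->; rewrite !eqxx.
case: n s => [|n] s [] // _ /eqP h1 /eqP h2 /eqP h3.
by exists n n.+1; rewrite ?size_letters.
Qed.

Local Notation x := (fun n => (av_count true true true true true n)%:R : R).
Local Notation y := (fun n => (av_count true true false true true n)%:R : R).

(* Coefficients of the exponential generating function
   [\sum_k t^(3k)/(3k)! - t^(3k+1)/(3k+1)!]. *)
Fixpoint bcoef (k : nat) : R :=
  match k with 0 => 1 | 1 => -1 | 2 => 0 | k'.+3 => bcoef k' end.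

Lemma bcoefSS k : bcoef k.+2 = - bcoef k.+1 - bcoef k.
Proof.
pose P k := bcoef k.+2 = - bcoef k.+1 - bcoef k.
suff : [/\ P k, P k.+1 & P k.+2] by case.
by elim: k => [|k [h0 h1 h2]]; split=> //; rewrite /P /=; ring.
Qed.

(** The series with coefficients [bcoef] is the reciprocal of the exponential generating function of
    x. Words are refined by last letter ([v]) and by ending in an ascent ([u]); the two coupled
    partial-sum recursions are solved by [bcoef], whose consecutive triples sum to 0. *)
Lemma av_count_123_consecutive n :
  \sum_(k < n.+2) bcoef k * 'C(n.+1, k)%:R * x (n.+1 - k)%N = 0.
Proof.
pose v := @avlast R true true true true true.
pose u m l : R := avsum true true true true true m
  (fun w => (last 0%N w == l)%:R * (asc w)%:R).
have vS m l : (l <= m.+1)%N -> v m.+2 l = x m.+1 - \sum_(k < l) u m.+1 k.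
  move=> lm; rewrite /v avlast_grow // /u -avsum_last avsum1 -avsumB.
  apply: eq_avsum => s _; rewrite completes_consecutive /asc size_letters ltnS !eqb_id.
  case: (0 < m)%N => /=; last by rewrite mulr0 subr0.
  case: (ltnP (penult _) (last _ _)) => /= h1; last by rewrite mulr0 subr0.
  case: (ltnP (last _ _) l) => h2 /=; last by rewrite mul0r subr0 andbF.
  by rewrite (ltn_trans h1 h2) mulr1 subrr.
have uS m l : (l <= m.+1)%N -> u m.+2 l = \sum_(k < l) (v m.+1 k - u m.+1 k).
  move=> lm; rewrite /u avsum_grow // sumrB /v -avlast_lt -avsum_last -avsumB.
  apply: eq_avsum => s _; rewrite asc_grow completes_consecutive /asc size_letters ltnS !eqb_id.
  case: (ltnP (last _ _) l) => h2 /=; last by rewrite mulr0 mul0r subrr.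
  rewrite mulr1 mul1r andbT; case: (0 < m)%N => /=; last by rewrite subr0.
  case: (ltnP (penult _) (last _ _)) => /= h1; last by rewrite subr0.
  by rewrite (ltn_trans h1 h2) subrr.
have key m l : (l <= m)%N ->
    v m.+1 l = - \sum_(i < m.+1) bcoef i.+1 * x (m - i)%N * 'C(l, i)%:R /\
    u m.+1 l = \sum_(i < m.+1) bcoef i.+2 * x (m - i)%N * 'C(l, i)%:R.
  elim: m l => [|m IH] l lm.
    move: lm; rewrite leqn0 => /eqP ->; rewrite !big_ord1 bin0 /= !mul0r.
    split; first by rewrite /v avlast1 mulN1r mulNr opprK mulr1.
    rewrite /u avsum_grow // avsum0; case: asboolP => h /=; first by rewrite mul0r.
    by rewrite mulr0.
  have sub k : (k < l)%N -> (k <= m)%N by move=> kl; rewrite -ltnS (leq_trans kl).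
  have hockey (c : nat -> R) :
      \sum_(k < l) \sum_(i < m.+1) c i * 'C(k, i)%:R =
      \sum_(i < m.+1) c i * 'C(l, i.+1)%:R.
    rewrite exchange_big; apply: eq_bigr => i _.
    by rewrite -mulr_sumr sum_binom.
  split.
  - rewrite vS // big_ord_recl bin0 subn0 /= mulr1 mulN1r opprD opprK; congr (_ - _).
    rewrite (eq_bigr _ (fun (k : 'I_l) _ => (IH k (sub k (ltn_ord k))).2)).
    by rewrite (hockey (fun i => bcoef i.+2 * x (m - i)%N)).
  - rewrite uS // big_ord_recl /= mul0r mul0r add0r.
    rewrite -(hockey (fun i => bcoef i.+3 * x (m - i)%N)).
    apply: eq_bigr => k _; have [-> ->] := IH k (sub k (ltn_ord k)).
    rewrite -opprD -big_split -sumrN; apply: eq_bigr => i _.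
    by rewrite (bcoefSS i.+1) -[LHS]/(- (_ + _)); ring.
rewrite big_ord_recl bin0 subn0 !mul1r avlast_total -/v.
rewrite (eq_bigr _ (fun (l : 'I_n.+1) _ => (key n l (ltn_ord l)).1)) sumrN exchange_big.
apply/eqP; rewrite addrC subr_eq0; apply/eqP; apply: eq_bigr => i _.
by rewrite -mulr_sumr sum_binom lift0 subSS mulrAC.
Qed.

Lemma sum_leq_nat m l : \sum_(z < m) (l <= z)%N%:R = (m - l)%N%:R :> R.
Proof.
elim: m => [|m IH]; first by rewrite big_ord0.
rewrite big_ord_recr IH /=; case: leqP => h; first by rewrite subSn // natr1.
by rewrite addr0; congr (_%:R); lia.
Qed.

(** The letter l is refused after words with [penult w < l <= last 0 w]. Deleting the last letter z
    of such a word leaves an avoider ending below l. Conversely each of the n + 2 - l values z >= l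
    may be appended, since an ascent never completes 132. *)
Lemma avlast_132_consecutive n l : (l <= n.+2)%N ->
  avlast R true true false true true n.+3 l =
  y n.+2 - (n.+2 - l)%N%:R * \sum_(k < l) avlast R true true false true true n.+1 k.
Proof.
move=> ln; rewrite avlast_grow // -avlast_lt.
set c := avsum _ _ _ _ _ n.+1 _.
have -> : (n.+2 - l)%N%:R * c = avsum true true false true true n.+2
    (fun w => ((penult w < l)%N && (l <= last 0%N w)%N)%:R).
  rewrite avsumS /c /avsum mulr_sumr; apply: eq_bigr => s avs.
  have M : (n.+2 - l)%N%:R = \sum_(z < n.+2) (l <= z)%N%:R :> R.
    by rewrite sum_leq_nat.
  rewrite M mulr_suml [RHS]big_mkcond; apply: eq_bigr => z _ /=.
  rewrite completes_consecutive penult_grow ?size_letters // last_grow -natrM mulnb.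
  case: (leqP l z) => lz /=; last by rewrite andbF if_same.
  rewrite andbT /bump.
  case: (leqP z (last 0%N (letters s))) => h; last by rewrite !andbF add0n.
  by rewrite add1n !ltnNge (leqW (leq_trans lz h)) (leq_trans lz h) if_same.
rewrite avsum1 -avsumB; apply: eq_avsum => s _.
rewrite completes_consecutive /= eqb_id eqbF_neg -leqNgt.
case: (ltnP (penult _) l) => h1 /=; last by rewrite andbF subr0.
case: (leqP l (last _ _)) => h2 /=; last by rewrite !andbF subr0.
by rewrite (leq_trans h1 h2) subrr.
Qed.

End Consecutive.

(** * Orthogonal polynomials *)

Section OrthogonalPolynomials.
Variable R : comNzRingType.
Implicit Types (x al be : nat -> R) (P : nat -> {poly R}).

(** The recurrence expands X^n in the P_k with coefficients [motz al be n k]; the functional keeps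
    only the coefficient of P_0. *)
Lemma jfrac_of_orthogonal x al be P : P 0%N = 1 ->
  'X * P 0%N = P 1%N + al 0%N *: P 0%N ->
  (forall k, 'X * P k.+1 = P k.+2 + al k.+1 *: P k.+1 + be k.+1 *: P k) ->
  x 0%N = 1 -> (forall k, momf x (P k.+1) = 0) ->
  forall n, x n = jfrac al be n.
Proof.
move=> P0 XP0 XP x0 ortho n; rewrite jfrac_motz.
have XnE : 'X^n = \sum_(k < n.+1) motz al be n k *: P k.
  elim: n => [|n IH]; first by rewrite big_ord1 scale1r P0.
  pose c k := motz al be n k.
  pose Q k := if k is j.+1 then be k *: P j else 0.
  have XPE k : 'X * P k = P k.+1 + al k *: P k + Q k.
    by case: k => [|k]; rewrite ?addr0.
  rewrite exprS {}IH mulr_sumr.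
  under eq_bigr => k _ do rewrite -scalerAr XPE 2!scalerDr.
  under [RHS]eq_bigr => k _ do rewrite motzS 2!scalerDl.
  rewrite !big_split /=; congr (_ + _ + _).
  - by rewrite [RHS]big_ord_recl /= scale0r add0r.
  - rewrite [RHS]big_ord_recr /= (@motz_gt _ _ _ n n.+1) // mulr0 scale0r addr0.
    by apply: eq_bigr => k _; rewrite scalerA mulrC.
  - rewrite [RHS]big_ord_recr /= (@motz_gt _ _ _ n n.+2) // mulr0 scale0r addr0.
    rewrite [RHS]big_ord_recr /= (@motz_gt _ _ _ n n.+1) // mulr0 scale0r addr0.
    rewrite big_ord_recl /= scaler0 add0r; apply: eq_bigr => k _.
    by rewrite /bump /= add1n scalerA mulrC.
rewrite -(momfXn x) XnE linear_sum big_ord_recl big1 /= => [|k _].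
  by have := momfXn x 0; rewrite expr0 addr0 linearZ /= P0 => ->; rewrite x0 mulr1.
by rewrite linearZ /= ortho mulr0.
Qed.

Lemma eq_scalar_Xn (f g : {poly R} -> R) : scalar f -> scalar g ->
  (forall n, f 'X^n = g 'X^n) -> f =1 g.
Proof.
move=> lf lg e.
pose F : {scalar {poly R}} := HB.pack f (GRing.isLinear.Build R {poly R} R *%R f lf).
pose G : {scalar {poly R}} := HB.pack g (GRing.isLinear.Build R {poly R} R *%R g lg).
exact: (@eq_scalarXn _ F G).
Qed.

End OrthogonalPolynomials.

Lemma polyC_natr (R : nzRingType) m : (m%:R : {poly R}) = (m%:R)%:P.
Proof. by rewrite rmorph_nat. Qed.

Section Bell.
Variables (R : comNzRingType) (x : nat -> R).

(* Umbral form of the exponential generating function identity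
   [B'(t) = e^t B(t)]. *)
Hypothesis umbral : forall p, momf x ('X * (p \Po ('X - 1))) = momf x p.
Hypothesis x0 : x 0%N = 1.

Let E (p : {poly R}) : {poly R} := 'X * (p \Po ('X - 1)) - p.

Let ED p q : E (p + q) = E p + E q.
Proof. by rewrite /E comp_polyD; ring. Qed.

Let EZ c p : E (c *: p) = c *: E p.
Proof. by rewrite /E comp_polyZ -!mul_polyC; ring. Qed.

Let EX p : 'X * E p = E ('X * p) + E p + p.
Proof. by rewrite /E comp_polyM comp_polyX; ring. Qed.

Let XE1 : 'X = E 1 + 1.
Proof. by rewrite /E -polyC1 comp_polyC polyC1 mulr1 subrK. Qed.

(** The iterates E^k 1 are the Charlier polynomials of parameter 1. The functional kills the range
    of E, and the commutation rule [EX] yields the three-term recurrence by induction. *)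
Lemma jfrac_bell n :
  x n = jfrac (fun k => k.+1%:R) (fun k => k%:R) n.
Proof.
have [P [P0 PS]] : exists P, P 0%N = 1 /\ forall k, P k.+1 = E (P k).
  by exists (fun k => iter k E 1).
apply: (@jfrac_of_orthogonal _ _ _ _ P) => //.
- by rewrite PS P0 scale1r mulr1 XE1.
- elim=> [|k IH].
    by rewrite !PS P0 EX mulr1 {1}XE1 ED scale1r scaler_nat; ring.
  rewrite {1}PS EX IH !ED !EZ -!PS.
  rewrite -!mul_polyC -!polyC_natr -(natr1 k.+1) -(natr1 k).
  by ring.
- by move=> k; rewrite PS /E linearB /= umbral subrr.
Qed.

End Bell.

Section Umbral123.
Variables (R : comNzRingType) (x : nat -> R).

(* The operator [sum_k b_k D^k / k!], where [D] is the derivation. *)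
Definition dop (b : nat -> R) (p : {poly R}) : {poly R} :=
  \sum_(k < size p) b k *: p^`N(k).

Lemma dop_wide b (p : {poly R}) n : (size p <= n)%N ->
  dop b p = \sum_(k < n) b k *: p^`N(k).
Proof.
move=> le; rewrite /dop (big_ord_widen n (fun k => b k *: p^`N(k))) //.
rewrite big_mkcond; apply: eq_bigr => k _; case: ltnP => // h.
by rewrite nderivn_poly0 ?scaler0.
Qed.

Lemma dopP b c (p q : {poly R}) : dop b (c *: p + q) = c *: dop b p + dop b q.
Proof.
set n := maxn (size p) (size q).
have hp : (size (c *: p + q)%R <= n)%N.
  apply: leq_trans (size_polyD _ _) _; rewrite geq_max leq_maxr andbT.
  by apply: leq_trans (size_scale_leq _ _) (leq_maxl _ _).
rewrite (dop_wide b hp) (@dop_wide b p n) ?leq_maxl // (@dop_wide b q n) ?leq_maxr //.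
rewrite scaler_sumr -big_split; apply: eq_bigr => k _.
by rewrite /= nderivnD nderivnZ scalerDr !scalerA mulrC.
Qed.

Lemma dop_Xmul b (p : {poly R}) :
  dop b ('X * p) = 'X * dop b p + dop (b \o S) p.
Proof.
have sz : (size ('X * p)%R <= (size p).+1)%N.
  by apply: leq_trans (size_polyMleq _ _) _; rewrite size_polyX.
rewrite (dop_wide b sz) (@dop_wide b p (size p).+1) //.
rewrite big_ord_recl nderivn0 [\sum_(_ < (size p).+1) _]big_ord_recl nderivn0.
rewrite mulrDr scalerAr -addrA; congr (_ + _).
rewrite /dop mulr_sumr -big_split; apply: eq_bigr => k _ /=.
rewrite /bump /= add1n -scalerAr -scalerDr; congr (_ *: _).
have := nderivnMXaddC k p 0; rewrite polyC0 addr0 mulrC => ->.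
by rewrite addrC mulrC.
Qed.

(* [dop bcoef] maps these polynomials to the orthogonal polynomials of the consecutive
   pattern 123. *)
Fixpoint gpoly (k : nat) : {poly R} :=
  match k with
  | 0 => 1
  | 1 => 'X
  | (k'.+1 as j).+1 => 'X * gpoly j - (j%:R * gpoly j + (j * k')%:R * gpoly k')
  end.

Let gpolySS k : gpoly k.+2 =
  'X * gpoly k.+1 - (k.+1%:R * gpoly k.+1 + (k.+1 * k)%:R * gpoly k).
Proof. by []. Qed.

Lemma gpoly_eval0 k : (gpoly k.+1).[0] = 0.
Proof.
(* The factor k makes the second conjunct true at k = 0, where [gpoly 0] is 1. *)
have [//] : (gpoly k.+1).[0] = 0 /\ k%:R * (gpoly k).[0] = 0.
elim: k => [|k [h1 h2]]; first by rewrite hornerX mul0r.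
split; last by rewrite h1 mulr0.
rewrite gpolySS !polyC_natr !hornerD hornerN !hornerD !hornerM !hornerC hornerX h1.
by rewrite natrM -mulrA h2; ring.
Qed.

Let b := bcoef R.

Let dopD c p q : dop c (p + q) = dop c p + dop c q.
Proof. by rewrite -[p]scale1r dopP !scale1r. Qed.

Let dopZ c a p : dop c (a *: p) = a *: dop c p.
Proof.
have d0 : dop c 0 = 0 by rewrite /dop size_poly0 big_ord0.
by rewrite -[a *: p]addr0 dopP d0 addr0.
Qed.

Let dop1 c : dop c 1 = (c 0%N)%:P.
Proof. by rewrite /dop size_poly1 big_ord1 nderivn0 -mul_polyC mulr1. Qed.

Let dopSS p : dop (b \o S \o S) p = - dop (b \o S) p - dop b p.
Proof.
rewrite /dop -!sumrN -big_split; apply: eq_bigr => k _ /=.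
by rewrite -!scaleNr -scalerDl; congr (_ *: _); exact: bcoefSS.
Qed.

Let dop_natr c m p : dop c (m%:R * p) = m%:R * dop c p.
Proof. by rewrite !mulr_natl -!scaler_nat dopZ. Qed.

Let dop_gpolySS c k : dop c (gpoly k.+2) = 'X * dop c (gpoly k.+1) +
  dop (c \o S) (gpoly k.+1) -
  (k.+1%:R * dop c (gpoly k.+1) + (k.+1 * k)%:R * dop c (gpoly k)).
Proof.
rewrite gpolySS -scaleN1r dopD dopZ dopD !dop_natr dop_Xmul.
by rewrite scaleN1r.
Qed.

(** The [gpoly k] have exponential generating function exp(x f(t)) with f' = 1/(1 + t + t^2). If Q
    lowers [gpoly k.+1] to (k+1) [gpoly k], the claim reads B' = -(1 + Q) B at D, where B is the
    series of b. It rests on B'' = -B' - B, that is [dopSS]. *)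
Let dop_gpoly k : dop (b \o S) (gpoly k.+1) =
  - dop b (gpoly k.+1) - k.+1%:R * dop b (gpoly k).
Proof.
pose C k := dop (b \o S) (gpoly k.+1) =
  - dop b (gpoly k.+1) - k.+1%:R * dop b (gpoly k).
have X1 c : dop c 'X = 'X * (c 0%N)%:P + (c 1%N)%:P.
  by rewrite -['X]mulr1 dop_Xmul !dop1 mulr1.
have C0 : C 0%N by rewrite /C /= !X1 !dop1 /b /= ?polyCN ?polyC0 ?polyC1; ring.
have [//] : C k /\ C k.+1.
elim: k => [|k [h1 h2]]; split=> //; rewrite /C.
  rewrite !dop_gpolySS dopSS C0 /= !X1 !dop1 /b /= ?polyCN ?polyC0 ?polyC1.
  by ring.
rewrite (dop_gpolySS (b \o S) k.+1) (dop_gpolySS b k.+1) dopSS h2.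
rewrite (dop_gpolySS b k) h1 !natrM -(natr1 k.+1) -(natr1 k); ring.
Qed.

Hypothesis umbral : forall p, momf x (dop b p) = p.[0].

Lemma jfrac_umbral123 n :
  x n = jfrac (fun k => k.+1%:R) (fun k => k%:R * k%:R) n.
Proof.
apply: (@jfrac_of_orthogonal _ _ _ _ (fun k => dop b (gpoly k))).
- by rewrite dop1.
- rewrite /= -['X in RHS]mulr1 dop_Xmul !dop1 /b /= polyCN polyC1 scale1r; ring.
- move=> k; rewrite dop_gpolySS dop_gpoly -!mul_polyC polyCM -!polyC_natr.
  rewrite !natrM -(natr1 k.+1) -(natr1 k).
  by ring.
- by have := umbral 1; rewrite dop1 hornerE /b /= polyC1 -(expr0 'X) momfXn.
- by move=> k; rewrite umbral gpoly_eval0.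
Qed.

End Umbral123.

Section MomentJFractions.
Variable R : comNzRingType.

Lemma jfrac_1_32 n : (av_count true true false false true n)%:R =
  jfrac (fun k => k.+1%:R : R) (fun k => k%:R) n.
Proof.
move: n; set x := fun n => (av_count true true false false true n)%:R : R.
have x0 : x 0%N = 1 by rewrite /x avsum1 avsum0.
(* Umbral form of the Bell recurrence; replacing p by p(X - 1) turns it into the hypothesis of
   [jfrac_bell]. *)
have shift p : momf x ('X * p) = momf x (p \Po ('X + 1)).
  apply: (@eq_scalar_Xn _ (fun p => momf x ('X * p)) (fun p => momf x (p \Po ('X + 1)))).
  - by move=> a u v; rewrite mulrDr -scalerAr linearP.
  - by move=> a u v; rewrite linearP linearP.
  move=> n; rewrite -exprS momfXn comp_Xn_poly exprDn linear_sum /x av_count_1_32.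
  apply: eq_bigr => i _; rewrite expr1n mulr1 linearMn /= momfXn -[RHS]mulr_natl.
  by [].
apply: jfrac_bell => // p; rewrite shift -comp_polyA.
by rewrite comp_polyB comp_polyX comp_polyC addrK comp_polyXr.
Qed.

Lemma jfrac_1_23 n : (av_count true true true false true n)%:R =
  jfrac (fun k => k.+1%:R : R) (fun k => k%:R) n.
Proof.
move: n; set x := fun n => (av_count true true true false true n)%:R : R.
have x0 : x 0%N = 1 by rewrite /x avsum1 avsum0.
apply: jfrac_bell => //.
apply: (@eq_scalar_Xn _ (fun p => momf x ('X * (p \Po ('X - 1)))) (momf x)).
- by move=> a u v; rewrite linearP mulrDr -scalerAr linearP.
- by move=> a u v; rewrite linearP.
move=> n; rewrite momfXn -[RHS]av_count_1_23 comp_Xn_poly exprBn mulr_sumr linear_sum.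
rewrite [RHS]big_ord_recr /= bin_small // mulr0 mul0r addr0; apply: eq_bigr => i _.
have -> : 'X * ((-1) ^+ i * 'X^(n - i) * 1 ^+ i *+ 'C(n, i)) =
    ((-1) ^+ i * 'C(n, i)%:R) *: 'X^(n.+1 - i) :> {poly R}.
  rewrite expr1n mulr1 subSn -1?ltnS // exprS -mulr_natr polyC_natr.
  by rewrite -mul_polyC polyCM polyC_exp polyCN polyC1; ring.
by rewrite linearZ /= momfXn.
Qed.

Lemma jfrac_123_consecutive n : (av_count true true true true true n)%:R =
  jfrac (fun k => k.+1%:R : R) (fun k => k%:R * k%:R) n.
Proof.
move: n; set x := fun n => (av_count true true true true true n)%:R : R.
have x0 : x 0%N = 1 by rewrite /x avsum1 avsum0.
apply: jfrac_umbral123.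
apply: (@eq_scalar_Xn _ (fun p => momf x (dop (bcoef R) p)) (horner^~ 0)).
- by move=> a u v; rewrite dopP linearP.
- by move=> a u v; rewrite hornerD hornerZ.
move=> n; rewrite hornerXn /dop size_polyXn linear_sum.
transitivity (\sum_(k < n.+1) bcoef R k * 'C(n, k)%:R * x (n - k)%N).
  apply: eq_bigr => k _; rewrite nderivnXn linearZ linearMn /= momfXn.
  by rewrite -[x _ *+ _]mulr_natl mulrA.
case: n => [|n]; last by rewrite av_count_123_consecutive expr0n.
by rewrite big_ord1 /= x0 !mul1r.
Qed.

End MomentJFractions.

(** * The two sides of the equivalence *)

Lemma momf_mul (R : comNzRingType) (x : nat -> R) (p q : {poly R}) m n :
  (size p <= m)%N -> (size q <= n)%N ->
  momf x (p * q) = \sum_(i < m) \sum_(j < n) p`_i * q`_j * x (i + j)%N.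
Proof.
move=> pm qn.
have wide (r : {poly R}) k : (size r <= k)%N -> r = \sum_(i < k) r`_i *: 'X^i.
  move=> rk; rewrite -poly_def; apply/polyP => i; rewrite coef_poly.
  by case: ltnP => // /(leq_trans rk) /leq_sizeP ->.
rewrite {1}(wide _ _ pm) {1}(wide _ _ qn) mulr_suml linear_sum.
apply: eq_bigr => i _; rewrite mulr_sumr linear_sum; apply: eq_bigr => j _.
by rewrite -scalerAl -scalerAr -exprD !linearZ /= momfXn mulrA.
Qed.

Section MomentSequences.
Variable R : realType.

Lemma moment_sqr_ge0 (x : nat -> R) : is_moment_sequence x ->
  forall p, 0 <= momf x (p * p).
Proof.
move=> [mu hmu] p; rewrite -lee_fin; set q := p * p.
have -> : ((momf x q)%:E = \int[mu]_y (q.[y])%:E)%E.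
  have -> : (fun y : measurableTypeR R => (q.[y])%:E) =
      (fun y => \sum_(i < size q) (q`_i)%:E * (y ^+ i)%:E)%E.
    by apply/funext => y; rewrite horner_coef -sumEFin.
  rewrite integral_sum //; last first.
    by move=> i; apply: integrableZl => //; exact: (hmu i).1.
  rewrite /momf -sumEFin; apply: eq_bigr => i _.
  by rewrite integralZl ?(hmu i).2 //; exact: (hmu i).1.
by apply: integral_ge0 => y _; rewrite lee_fin hornerM -expr2 sqr_ge0.
Qed.

Lemma jfrac_moment (al be x : nat -> R) : (forall n, 0 <= be n.+1) ->
  (forall n, x n = jfrac al be n) -> is_moment_sequence x.
Proof. by move=> be0 xE; apply: hamburger; exact: momf_sqr_ge0 xE. Qed.

End MomentSequences.

(** * Signs of the two-parameter brackets *)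

Section Brackets.
Variable R : realType.
Implicit Types x y : R.

Lemma brackS x y n : brack x y n.+1 = x ^+ n + y * brack x y n.
Proof.
rewrite /brack big_ord_recl subn0 expr0 mulr1 subn1; congr (_ + _).
rewrite mulr_sumr; apply: eq_bigr => i _; rewrite lift0 exprS mulrCA.
by congr (_ * (x ^+ _ * _)); lia.
Qed.

Lemma brackSr x y n : brack x y n.+1 = x * brack x y n + y ^+ n.
Proof.
rewrite /brack big_ord_recr /= subn1 subnn mul1r; congr (_ + _).
rewrite mulr_sumr; apply: eq_bigr => i _; rewrite mulrA -exprS.
by congr (x ^+ _ * _); have := ltn_ord i; lia.
Qed.

Lemma brack_ge0 x y n : 0 <= x -> 0 <= y -> 0 <= brack x y n.
Proof. by move=> x0 y0; apply: sumr_ge0 => i _; rewrite mulr_ge0 ?exprn_ge0. Qed.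

Lemma brack_double x y m : brack x y m.*2 = (x + y) * brack (x ^+ 2) (y ^+ 2) m.
Proof.
elim: m => [|m IH]; first by rewrite /brack !big_ord0 mulr0.
rewrite doubleS !brackS IH (exprS x m.*2) -exprM mul2n.
by move: (x ^+ m.*2) (brack _ _ m) => X B; ring.
Qed.

(** Adding the two expansions [brackS] and [brackSr] gives x^(2m) + y^(2m) + (x + y)^2 [m] with [m]
    taken at (x^2, y^2): every term is nonnegative whatever the signs of x and y. *)
Lemma brack_double1_ge0 x y m : 0 <= brack x y m.*2.+1.
Proof.
suff : 0 <= brack x y m.*2.+1 + brack x y m.*2.+1 by lra.
rewrite {1}brackS brackSr brack_double -mul2n !exprM.
set B := brack _ _ m.
have B0 : 0 <= B by rewrite brack_ge0 ?sqr_ge0.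
have -> : (x ^+ 2) ^+ m + y * ((x + y) * B) + (x * ((x + y) * B) + (y ^+ 2) ^+ m) =
  (x ^+ 2) ^+ m + (y ^+ 2) ^+ m + (x + y) ^+ 2 * B by ring.
apply: addr_ge0; first by apply: addr_ge0; apply: exprn_ge0; exact: sqr_ge0.
by rewrite mulr_ge0 ?sqr_ge0.
Qed.

Lemma brack1 x y : brack x y 1 = 1.
Proof. by rewrite brackS /brack big_ord0 mulr0 addr0. Qed.

Lemma brack2 x y : brack x y 2 = x + y.
Proof. by rewrite brackS brack1 mulr1 expr1. Qed.

Lemma brack11 n : brack 1 1 n = n%:R :> R.
Proof.
elim: n => [|n IH]; first by rewrite /brack big_ord0.
by rewrite brackS expr1n IH mul1r addrC natr1.
Qed.

Lemma brack10 n : brack 1 0 n.+1 = 1 :> R.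
Proof. by rewrite brackS expr1n mul0r addr0. Qed.

(** Odd brackets are nonnegative, and even ones carry the sign of c + d or h + l, whose product has
    its sign fixed by the second coefficient. *)
Lemma betaC_ge0 (c d h l p r : R) :
  0 < betaC c d h l p r 1 -> 0 <= betaC c d h l p r 2 -> forall n, 0 <= betaC c d h l p r n.+1.
Proof.
rewrite /betaC !brack1 !brack2 !mulr1 => pr1 b2 n.
rewrite -mulrA pmulr_rge0 //; rewrite -mulrA pmulr_rge0 // in b2.
rewrite -(odd_double_half n.+1); case: odd; rewrite ?add1n ?add0n.
  by rewrite mulr_ge0 ?brack_double1_ge0.
rewrite !brack_double mulrACA mulr_ge0 // mulr_ge0 // brack_ge0 ?sqr_ge0 //.
Qed.

End Brackets.

(** * The consecutive pattern 132 *)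

Section Consecutive132.
Variable R : realType.

Local Notation x := (fun n => (av_count true true false true true n)%:R : R).
Local Notation A := (avlast R true true false true true).

Definition zsum (s : seq int) : int := foldr +%R 0 s.

Definition next_row (n : nat) (r1 r2 : seq int) : seq int :=
  [seq zsum r2 - (n.+2 - l)%N%:Z * zsum (take l r1) | l <- iota 0 n.+3].

(** Avoiders of lengths n + 1 and n + 2 by last letter; the recurrence reaches back two lengths, so
    two rows are carried. Integers make the table computable. *)
Fixpoint rows (n : nat) : seq int * seq int :=
  if n is m.+1 then
    let: (r1, r2) := rows m in (r2, next_row m r1 r2)
  else ([:: 1], [:: 1; 1]).

Definition count132 (n : nat) : int :=
  if n is m.+1 then zsum (rows m).1 else 1.

Let zsumE (s : seq int) n (f : nat -> R) : size s = n ->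
  (forall l, (l < n)%N -> f l = (nth 0 s l)%:~R) ->
  \sum_(l < n) f l = (zsum s)%:~R.
Proof.
elim: s n f => [|z s IH] [|n] f //= => [_ _|[sn] h]; first by rewrite big_ord0.
rewrite big_ord_recl (h 0%N) // intrD; congr (_ + _).
under eq_bigr => l _ do rewrite lift0.
by apply: (IH n (fun l => f l.+1)) => // l ln; rewrite h.
Qed.

Let rowsP n :
  [/\ size (rows n).1 = n.+1, size (rows n).2 = n.+2,
      forall l, (l < n.+1)%N -> A n.+1 l = (nth 0 (rows n).1 l)%:~R &
      forall l, (l < n.+2)%N -> A n.+2 l = (nth 0 (rows n).2 l)%:~R].
Proof.
have x0 : x 0%N = 1 by rewrite avsum1 avsum0.
elim: n => [|n] /=.
  have A10 : A 1 0 = 1 by rewrite avlast1.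
  split=> // [[|//] _|l l2]; first by rewrite A10.
  have -> : nth 0 [:: 1; 1] l = 1 :> int by case: l l2 => [|[|]].
  rewrite avlast_grow //; transitivity (x 1%N).
    by rewrite avsum1; apply: eq_avsum => s _; rewrite completes_consecutive.
  by rewrite avlast_total big_ord1 avlast1 x0.
case: (rows n) => r1 r2 /= [s1 s2 h1 h2]; split=> //.
  by rewrite size_map size_iota.
move=> l ln; rewrite (nth_map 0%N) ?size_iota // nth_iota // add0n.
rewrite avlast_132_consecutive // avlast_total (zsumE s2 h2) intrB intrM.
(* At l = n + 2 the prefix would exceed the n + 1 entries of [r1], but its factor is 0. *)
congr (_ - _); have [ln1|ln2] := leqP l n.+1; last first.
  by rewrite (_ : (n.+2 - l)%N = 0%N) ?mul0r //; apply/eqP; rewrite subn_eq0.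
congr (_ * _); apply: zsumE => [|k kl].
  by rewrite size_takel // s1.
by rewrite nth_take // h1 // (leq_trans kl).
Qed.

Lemma av_count_132_consecutive n : x n = (count132 n)%:~R.
Proof.
case: n => [|n] /=; first by rewrite avsum1 avsum0.
by have [s1 _ h1 _] := rowsP n; rewrite avlast_total (zsumE s1 h1).
Qed.

(* An integer polynomial close to the fifth orthogonal polynomial: the first
   negative Hankel determinant is the one of size 6. *)
Let q : seq int := [:: 22; 269; -381; 152; -22; 1].

Lemma not_moment_132_consecutive : ~ is_moment_sequence x.
Proof.
move=> /moment_sqr_ge0 h.
have := h (\poly_(i < 6) (nth 0 q i)%:~R).
rewrite (momf_mul _ (size_poly _ _) (size_poly _ _)).
suff -> : \sum_(i < 6) \sum_(j < 6)
    (\poly_(i < 6) (nth 0 q i)%:~R)`_i * (\poly_(i < 6) (nth 0 q i)%:~R)`_j *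
    x (i + j)%N = (-770)%:~R :> R.
  by rewrite ler0z.
transitivity ((\sum_(i < 6) \sum_(j < 6)
   nth 0 q i * nth 0 q j * count132 (i + j))%:~R : R).
  rewrite rmorph_sum; apply: eq_bigr => i _.
  rewrite rmorph_sum; apply: eq_bigr => j _.
  by rewrite !coef_poly !ltn_ord av_count_132_consecutive /= -!intrM.
congr (_%:~R); rewrite !big_ord_recl !big_ord0.
by vm_compute.
Qed.

End Consecutive132.

Section Main.
Variable R : realType.

Definition is_fracC (x : nat -> R) : Prop :=
  exists a b c d f g h l p r s t u w : R,
    forall n, x n = fracC a b c d f g h l p r s t u w n.

(** The down-weights are compared from index 1 on: [catalan_be] is 1 at 0, where [betaC] is 0. *)
Lemma eq_jfrac (al al' be be' : nat -> R) n : al =1 al' ->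
  (forall k, be k.+1 = be' k.+1) -> jfrac al be n = jfrac al' be' n.
Proof.
move=> eal ebe; rewrite !jfrac_motz; move: 0%N.
by elim: n => [//|n IH] k; rewrite !motzS eal ebe !IH; case: k => [|k] /=; rewrite ?IH.
Qed.

Lemma moment_fracC (x : nat -> R) (a b c d f g h l p r s t u w : R) :
  (forall n, 0 <= betaC c d h l p r n.+1) ->
  (forall n, x n = fracC a b c d f g h l p r s t u w n) ->
  is_moment_sequence x <-> is_fracC x.
Proof.
move=> be0 xE; split=> _; first by exists a, b, c, d, f, g, h, l, p, r, s, t, u, w.
exact: jfrac_moment be0 xE.
Qed.

(** The bracket at (1, 0) is 0 at n = 0 and 1 afterwards, which separates [alpha_0 = 1] from the
    later 2; in the next classes the bracket at (1, 1) supplies n. *)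
Lemma catalan_class (x : nat -> R) :
  (forall n, x n = jfrac (@catalan_al R) (@catalan_be R) n) ->
  is_moment_sequence x <-> is_fracC x.
Proof.
move=> xE; apply: (@moment_fracC x 1 0 1 0 0 0 1 0 1 1 1 0 1 1) => n.
  by rewrite /betaC !brack10 !mulr1.
rewrite xE; apply: eq_jfrac => k; last by rewrite /betaC !brack10 !mulr1.
rewrite /alphaC expr1n mul0r addr0 !mul1r; case: k => [|k].
  by rewrite /brack big_ord0 addr0.
by rewrite brack10.
Qed.

Lemma bell_class (x : nat -> R) :
  (forall n, x n = jfrac (fun k => k.+1%:R) (fun k => k%:R) n) ->
  is_moment_sequence x <-> is_fracC x.
Proof.
move=> xE; apply: (@moment_fracC x 1 1 1 1 0 0 1 0 1 1 1 0 1 1) => n.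
  by rewrite /betaC brack11 brack10 !mul1r mulr1.
rewrite xE; apply: eq_jfrac => k; last by rewrite /betaC brack11 brack10 !mul1r mulr1.
by rewrite /alphaC brack11 expr1n mul0r addr0 !mul1r addrC natr1.
Qed.

Lemma consecutive123_class (x : nat -> R) :
  (forall n, x n = jfrac (fun k => k.+1%:R) (fun k => k%:R * k%:R) n) ->
  is_moment_sequence x <-> is_fracC x.
Proof.
move=> xE; apply: (@moment_fracC x 1 1 1 1 0 0 1 1 1 1 1 0 1 1) => n.
  by rewrite /betaC !brack11 !mul1r mulr_ge0.
rewrite xE; apply: eq_jfrac => k; last by rewrite /betaC !brack11 !mul1r.
by rewrite /alphaC brack11 expr1n mul0r addr0 !mul1r addrC natr1.
Qed.

(* The first five terms force [beta_1 = 1] and [beta_2 = 3], hence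
   [beta_n >= 0] for all [n] in the family. *)
Lemma consecutive132_class :
  let x := fun n => (av_count true true false true true n)%:R : R in
  is_moment_sequence x <-> is_fracC x.
Proof.
move=> x; have nm := @not_moment_132_consecutive R.
(* Left to right contradicts [nm]; right to left, membership is shown to force nonnegative
   coefficients, hence a measure. *)
split=> // -[a [b [c [d [f [g [h [l [p [r [s [t [u [w xE]]]]]]]]]]]]]].
suff be0 n : 0 <= betaC c d h l p r n.+1 by exact: jfrac_moment be0 xE.
move: xE; rewrite /fracC; set al := alphaC _ _ _ _ _ _ _ _.
set be := betaC c d h l p r => xE.
have val m v : count132 m = v -> v%:~R = motz al be m 0.
  by move=> <-; rewrite -jfrac_motz -xE /x av_count_132_consecutive.
(* The counts 1, 2, 5, 16 determine in turn [al 0], [be 1], [al 1] and [be 2], each equation being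
   linear in its new unknown. *)
have /esym := val 1%N 1 erefl; have /esym := val 2%N 2 erefl.
have /esym := val 3%N 5 erefl; have /esym := val 4%N 16 erefl => /=.
rewrite !mulr0 !mulr1 !addr0 !add0r => e4 e3 e2 e1.
rewrite e1 in e2 e3 e4.
have b1 : be 1%N = 1 by lra.
rewrite b1 in e3 e4.
have a1 : al 1%N = 2 by lra.
rewrite a1 in e4.
have b2 : be 2%N = 3 by lra.
by apply: betaC_ge0; rewrite -/be ?b1 ?b2.
Qed.

(** The hypotheses exclude the two cyclic comparison triples, leaving the six words. Reversal
    exchanges the adjacency flags, which is why 13-2 is reached from 2-13. *)
Lemma av_count_class (b01 b02 b12 a1 a2 : bool) :
  (b01 -> b12 -> b02) -> (~~ b01 -> ~~ b12 -> ~~ b02) ->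
  let x := fun n => (av_count b01 b02 b12 a1 a2 n)%:R : R in
  is_moment_sequence x <-> is_fracC x.
Proof.
pose T b01 b02 b12 a1 a2 := let x := fun n => (av_count b01 b02 b12 a1 a2 n)%:R : R in
  is_moment_sequence x <-> is_fracC x.
have Tcompl c01 c02 c12 d1 d2 : T c01 c02 c12 d1 d2 ->
    T (~~ c01) (~~ c02) (~~ c12) d1 d2.
  by rewrite /T (funext (av_count_compl c01 c02 c12 d1 d2)).
have Trev c01 c02 c12 d1 d2 : T c01 c02 c12 d1 d2 ->
    T (~~ c12) (~~ c02) (~~ c01) d2 d1.
  by rewrite /T (funext (av_count_rev c01 c02 c12 d1 d2)).
have T123 d1 d2 : T true true true d1 d2.
  case: d1 d2 => -[].
  - by apply: consecutive123_class => n; exact: jfrac_123_consecutive.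
  - apply: (Tcompl false false false); apply: (Trev true true true).
    by apply: bell_class => n; exact: jfrac_1_23.
  - by apply: bell_class => n; exact: jfrac_1_23.
  - by apply: catalan_class => n; exact: av_count_123.
have T132 d1 d2 : T true true false d1 d2.
  case: d1 d2 => -[].
  - exact: consecutive132_class.
  - apply: (Tcompl false false true); apply: (Trev false true true).
    by apply: catalan_class => n; rewrite av_count_213_adjacent; exact: av_count_213.
  - by apply: bell_class => n; exact: jfrac_1_32.
  - apply: (Tcompl false false true); apply: (Trev false true true).
    by apply: catalan_class => n; exact: av_count_213.
case: b01; case: b12; case: b02 => // h1 h2.
- exact: T123.
- by have := h1 isT isT.
- exact: T132.
- by apply: (Trev true true false); exact: T132.
- by apply: (Tcompl true false false); apply: (Trev true true false); exact: T132.
- by apply: (Tcompl true true false); exact: T132.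
- by have := h2 isT isT.
- by apply: (Tcompl true true true); exact: T123.
Qed.

End Main.

Theorem corollary3 (R : realType) (pi : pattern 3) :
  is_moment_sequence (fun n : nat => (avoid_count pi n)%:R : R) <->
  (exists a b c d f g h l p r s t u w : R, forall n : nat,
     (avoid_count pi n)%:R = fracC a b c d f g h l p r s t u w n).
Proof.
have := @av_count_class R _ _ _ _ _ _ _; rewrite /is_fracC.
rewrite (funext (avoid_countE pi)); apply.
- exact: ltn_trans.
- by rewrite -!leqNgt => h1 h2; exact: leq_trans h2 h1.
Qed.
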